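(* Let $r\ge s$ be positive integers. For $1\le k\le s-1$, the piecewise-linear map $\zeta_k\colon\mathbb R^{I_{k+1}}\to\mathbb R^{I_k}$ defined in the context defines a continuous, piecewise-linear, and lattice-preserving bijection from $\ell\cdot\widetilde{\mathcal C}(I_{k+1})$ to $\ell\cdot\widetilde{\mathcal C}(I_k)$ for all $\ell\in\mathbb Z_{\ge0}$. Hence, for fixed $r$ and $s$, the rational polytopes $\widetilde{\mathcal C}(I_k)$ ($1\le k\le s$) exhibit Ehrhart quasi-polynomial period collapse and share the same Ehrhart polynomial for all $k$.
   Context: $[n]=\{1,\dots,n\}$, and $\lessdot$ denotes cover relations. Posets (all with the componentwise order): the right trapezoid $RT_{r,s}=\{(i,j)\in[r+s-1]\times[s] : i-j<r\}$ and the trapezoid $T_{r,s}=\{(i,j)\in RT_{r,s}: i+j>s\}$. For $1\le k\le s$ the intermediate poset $I_k$ is the induced subposet of $RT_{r,s}$ on $T_{r,k}\cup[(k,k+1),(r+k-1,s)]$ (the second set is an interval of $RT_{r,s}$, empty when $k=s$). The left border of $RT_{r,s}$ is $L=\{(\ell+r-1,\ell):1\le\ell\le s\}$. A maximal chain $C$ of $I_k$ is polygonal if $C\cap L\ne\varnothing$ or $(k,1)\in C$. The polygonal chain polytope $\widetilde{\mathcal C}(I_k)\subseteq\mathbb R^{I_k}$ is the set of all $x=(x_p)_{p\in I_k}$ with $x_p\ge0$ for all $p\in I_k$ and $\sum_{p\in C}x_p\le1$ for all polygonal chains $C\subseteq I_k$. The piecewise-linear map $\zeta_k$ ($1\le k\le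 s-1$) is the tropicalization (replacing $(+,\cdot)$ by $(\max,+)$) of a birational map, given explicitly as follows. Let $M_k$ be the interval $[(k,1),(r+k,k+1)]$ of $RT_{r,s}$. For $x\in\mathbb R^{I_{k+1}}$, let $\bar x\in\mathbb R^{M_k}$ be obtained by restricting $x$ to $M_k\setminus\{(k,1)\}\subseteq I_{k+1}$ and setting $\bar x_{k,1}=0$ (any real value gives the same map). For $p\in M_k$ let $y_p=\max\sum_{i=1}^n\bar x_{q_i}$, the maximum being over all saturated chains $(k,1)=q_1\lessdot q_2\lessdot\cdots\lessdot q_n=p$ in $M_k$. Then $$\zeta_k(x)_{ij}=\begin{cases}\min\{y_q: q\in M_k,\ q\gtrdot(i,j)\}-y_{ij}&\text{if }(i,j)\in I_k\cap M_k=M_k\setminus\{(r+k,k+1)\},\\ x_{i+1,j}&\text{if }(i,j)\in I_k\setminus M_k\text{ and }j>k+1,\\ x_{i,j+1}&\text{if }(i,j)\in I_k\setminus M_k\text{ and }i<k.\end{cases}$$ Lattice-preserving means that lattice (integer) points are sent to lattice points. Period collapse here means that the Ehrhart quasi-polynomial of the rational polytope, i.e. the function counting lattice points of its $\ell$-th dilate for $\ell\in\mathbb Z_{\ge 0}$, is in fact a polynomial in $\ell$ (even if the polytope is not a lattice polytope). *)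

(* Defs.v *)
From HB Require Import structures.
From mathcomp Require Export all_boot all_order all_algebra finmap.
From mathcomp Require Export all_classical all_reals all_analysis.
Export Order.TTheory GRing.Theory Num.Theory numFieldNormedType.Exports.

Set Implicit Arguments.
Unset Strict Implicit.
Unset Printing Implicit Defensive.

Local Open Scope classical_set_scope.
Local Open Scope ring_scope.

(* [*p] carries the componentwise order; coordinates are 1-based. *)
Notation point := (nat *p nat)%type.

Definition pt (i j : nat) : point := (i, j).

(* The integer condition i - j < r is written without subtraction. *)
Definition right_trapezoid (r s : nat) : {fset point} :=
  [fset p in [seq pt i j | i <- iota 1 (r + s - 1), j <- iota 1 s]
     | (p.1 < r + p.2)%N]%fset.

Definition trapezoid (r s : nat) : {fset point} :=
  [fset p in right_trapezoid r s | (s < p.1 + p.2)%N]%fset.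

Definition interval_in (S : {fset point}) (a b : point) : {fset point} :=
  [fset p in S | (a <= p <= b)%O]%fset.

Definition intermediate (r s k : nat) : {fset point} :=
  (trapezoid r k
   `|` interval_in (right_trapezoid r s) (pt k (k + 1)) (pt (r + k - 1) s))%fset.

Definition left_border (r s : nat) : {fset point} :=
  [fset pt (l + r - 1) l | l in iota 1 s]%fset.

Definition is_chain (S : {fset point}) (C : {set S}) : bool :=
  [forall p in C, forall q in C, (val p >=< val q)%O].

Definition maximal_chain (S : {fset point}) (C : {set S}) : bool :=
  maxset (@is_chain S) C.

Definition polygonal (r s k : nat) (C : {set intermediate r s k}) : bool :=
  maximal_chain C &&
  ([exists p in C, val p \in left_border r s] || [exists p in C, val p == pt k 1]).

Definition polygonal_chain_polytope (R : realType) (r s k : nat) :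
    set (intermediate r s k -> R) :=
  [set x | (forall p, 0 <= x p) /\
           (forall C : {set intermediate r s k},
              polygonal C -> \sum_(p in C) x p <= 1)].

Definition dilate (R : realType) (A : Type) (l : nat) (P : set (A -> R)) :
    set (A -> R) :=
  [set (l%:R : R) *: x | x in P].

Definition lattice_point (R : realType) (A : Type) : set (A -> R) :=
  [set x | forall p, x p \is a Num.int].

(* q covers p in the induced subposet S. *)
Definition covered_by (S : {fset point}) : rel point := fun p q =>
  [&& p \in S, q \in S, (p < q)%O & [forall z : S, ~~ (p < val z < q)%O]].

Definition M_interval (r s k : nat) : {fset point} :=
  interval_in (right_trapezoid r s) (pt k 1) (pt (r + k) (k + 1)).

(* The coordinate of x at p; the junk value 0 off S is never used by [zeta]. *)
Definition coord (R : realType) (S : {fset point}) (x : S -> R) (p : point) : R :=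
  if insub p is Some q then x q else 0.

Section Zeta.
Variables (R : realType) (r s k : nat) (x : intermediate r s k.+1 -> R).

Definition xbar (p : point) : R := if p == pt k 1 then 0 else coord x p.

(* [sup] and [inf] (below) are taken over finite nonempty sets, hence are a
   maximum and a minimum. *)
Definition chain_max (p : point) : R :=
  sup [set \sum_(q <- pt k 1 :: c) xbar q | c in
        [set c : seq point | path (covered_by (M_interval r s k)) (pt k 1) c
                             /\ last (pt k 1) c = p]].

(* An element of [intermediate r s k] that is outside [M_interval r s k] and
   satisfies j <= k + 1 has i < k: this is the last branch. *)
Definition zeta (p : intermediate r s k) : R :=
  let i := (val p).1 in
  let j := (val p).2 in
  if val p \in M_interval r s k then
    inf [set chain_max q | q in
          [set q | covered_by (M_interval r s k) (val p) q]] - chain_max (val p)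
  else if (k + 1 < j)%N then coord x (pt (i + 1) j)
  else coord x (pt i (j + 1)).

End Zeta.

Definition polyhedron (R : realType) (A : finType) (P : set (A -> R)) : Prop :=
  exists (m : nat) (a : 'I_m -> A -> R) (b : 'I_m -> R),
    P = [set x | forall j, \sum_p a j p * x p <= b j].

(* The pieces are linear rather than affine, as for any tropicalization of a
   rational map with coefficients 1. *)
Definition piecewise_linear_on (R : realType) (A B : finType)
    (D : set (A -> R)) (f : (A -> R) -> (B -> R)) : Prop :=
  exists (n : nat) (P : 'I_n -> set (A -> R))
         (g : 'I_n -> {linear (A -> R) -> (B -> R)}),
    [/\ forall i, polyhedron (P i),
        D `<=` \bigcup_i P i &
        forall i x, D x -> P i x -> f x = g i x].

Definition lattice_preserving_on (R : realType) (A B : Type)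
    (D : set (A -> R)) (f : (A -> R) -> (B -> R)) : Prop :=
  forall x, D x -> lattice_point x -> lattice_point (f x).

(* [{ptws A -> R}] carries the product topology, i.e. the usual topology of R^A. *)
Definition continuous_on (R : realType) (A B : finType)
    (D : set (A -> R)) (f : (A -> R) -> (B -> R)) : Prop :=
  {within (D : set {ptws A -> R}), continuous (f : {ptws A -> R} -> {ptws B -> R})}.

(* P has finitely many lattice points in each dilate, and their number in the
   l-th dilate is the value at l of the polynomial q. *)
Definition is_Ehrhart_polynomial (R : realType) (A : Type) (P : set (A -> R))
    (q : {poly rat}) : Prop :=
  forall l : nat, exists n : nat,
    (dilate l P `&` @lattice_point R A #= `I_n)%card /\ n%:R = q.[l%:R].

(* Main.v *)
(** On M the map zeta_k is a composition of two transfer maps: y_p is the largest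
    x-weight of a chain from (k, 1) to p, and z_p = min {y_q : q covers p} - y_p.
    Reading both steps backwards shows that zeta_k is a bijection of the ambient
    spaces which preserves nonnegativity and integrality in both directions, so it
    remains to compare the maximal weights of the polygonal chains.

    Put d(i, j) = y(i+1, j) - y(i, j+1).  Up to a term depending only on the end
    points, the z-weight of a lattice path is minus the sum of its reduced costs:
    d(i, j)^+ for the step from (i, j) to (i+1, j) and d(i, j)^- for the step from
    (i, j) to (i, j+1).  The same holds for x-weights, except that the two costs of
    the unit square with lower left corner (i, j) sit on its top and right sides.
    Since one of d^+ and d^- always vanishes, crossing a row of squares after moving
    along its bottom costs at best as much as crossing it before moving along its
    top.  Exchanging row after row shifts a z-path to an x-path one column further
    right; exchanging columns shifts it one row up.  A chain that meets the left
    border L is shifted up until its last point of L and right afterwards, and a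
    chain from (k, 1) that avoids L is shifted right.

    For k = 1 the poset is a rectangle in which all maximal chains are polygonal,
    so lattice points of the l-th dilate correspond to order preserving maps to
    {0, ..., l}, whose number is a sum of binomial coefficients in l + 1. *)

From HB Require Import structures.
Require Import Defs.
From mathcomp Require Import zify ring lra.

Set Implicit Arguments.
Unset Strict Implicit.
Unset Printing Implicit Defensive.

Local Open Scope classical_set_scope.
Local Open Scope ring_scope.

(** * Lattice paths and the row exchange *)

Section RowExchange.
Variable R : realDomainType.

(** If some admissible crossing in [[u, v]] is free, that is [f] vanishes there, the rightmost such
    crossing gives cost 0: at every admissible place beyond it [f] is nonzero, so [e] vanishes. If
    no crossing is free, [e] vanishes on all of [[u, v]] and the crossing [w] can be kept. *)
Lemma row_exchange (e f : nat -> R) (ok : pred nat) (u w v : nat) :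
  (forall i, 0 <= e i) -> (forall i, 0 <= f i) ->
  (forall i, ~~ ok i -> e i = 0) -> (forall i, ok i -> e i = 0 \/ f i = 0) ->
  (u <= w <= v)%N -> ok w ->
  exists u', [/\ (u <= u' <= v)%N, ok u' &
    f u' + \sum_(u'.+1 <= i < v.+1) e i <= \sum_(u <= i < w) e i + f w].
Proof.
move=> e0 f0 nok okf uwv okw.
have [[i0 /andP[uiv /andP[oki /eqP fi]]]|none] :=
  pselect (exists i, (u <= i <= v)%N && (ok i && (f i == 0))).
  have ex0 : exists i, (u <= i <= v)%N && (ok i && (f i == 0)).
    by exists i0; rewrite uiv oki fi eqxx.
  have bnd i : (u <= i <= v)%N && (ok i && (f i == 0)) -> (i <= v)%N by lia.
  case: (ex_maxnP ex0 bnd) => u' /andP[u'uv /andP[oku' /eqP fu']] max_u'.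
  exists u'; split => //.
  rewrite fu' add0r big_nat_cond big1 => [|i /andP[/andP[ui iv] _]].
    by rewrite addr_ge0 // sumr_ge0.
  have [oki'|/nok//] := boolP (ok i).
  have [//|fi0] := okf _ oki'.
  by have := max_u' i; rewrite oki' fi0 eqxx !andbT => /(_ ltac:(lia)); lia.
exists w; split => //.
have ez i : (u <= i <= v)%N -> e i = 0.
  move=> uiv'; have [oki'|/nok//] := boolP (ok i).
  have [//|fi0] := okf _ oki'.
  by exfalso; apply: none; exists i; rewrite uiv' oki' fi0 eqxx.
by rewrite addrC lerD2r big_nat_cond big1 ?sumr_ge0 // => i Hi; apply: ez; lia.
Qed.

(** Mirror image of [row_exchange], with the leftmost free crossing. *)
Lemma row_exchange_rev (e f : nat -> R) (ok : pred nat) (u w v : nat) :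
  (forall i, 0 <= e i) -> (forall i, 0 <= f i) ->
  (forall i, ~~ ok i -> e i = 0) -> (forall i, ok i -> e i = 0 \/ f i = 0) ->
  (u <= w <= v)%N -> ok w ->
  exists u', [/\ (u <= u' <= v)%N, ok u' &
    \sum_(u <= i < u') e i + f u' <= f w + \sum_(w.+1 <= i < v.+1) e i].
Proof.
move=> e0 f0 nok okf uwv okw.
have [ex0|none] :=
  pselect (exists i, (u <= i <= v)%N && (ok i && (f i == 0))).
  case: (ex_minnP ex0) => u' /andP[u'uv /andP[oku' /eqP fu']] min_u'.
  exists u'; split => //.
  rewrite fu' addr0 big_nat_cond big1 => [|i /andP[/andP[ui iv] _]].
    by rewrite addr_ge0 // sumr_ge0.
  have [oki'|/nok//] := boolP (ok i).
  have [//|fi0] := okf _ oki'.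
  by have := min_u' i; rewrite oki' fi0 eqxx !andbT => /(_ ltac:(lia)); lia.
exists w; split => //.
have ez i : (u <= i <= v)%N -> e i = 0.
  move=> uiv'; have [oki'|/nok//] := boolP (ok i).
  have [//|fi0] := okf _ oki'.
  by exfalso; apply: none; exists i; rewrite uiv' oki' fi0 eqxx.
by rewrite addrC lerD2l big_nat_cond big1 ?sumr_ge0 // => i Hi; apply: ez; lia.
Qed.

End RowExchange.

Section LatticePath.
Variable R : realDomainType.
Implicit Types (A : nat -> nat -> bool -> bool) (C : nat -> nat -> bool -> R).

(* [A i j b] allows the unit step out of (i, j), upwards if [b] and to the right
   otherwise; [C i j b] is its weight. *)
Inductive lpath A C : nat -> nat -> nat -> nat -> R -> Prop :=
| lpath_nil i j : lpath A C i j i j 0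
| lpath_right i j i' j' c : A i j false -> lpath A C i.+1 j i' j' c ->
    lpath A C i j i' j' (C i j false + c)
| lpath_up i j i' j' c : A i j true -> lpath A C i j.+1 i' j' c ->
    lpath A C i j i' j' (C i j true + c).

Lemma lpath_le A C i j i' j' c :
  lpath A C i j i' j' c -> (i <= i')%N && (j <= j')%N.
Proof. by elim=> *; lia. Qed.

Lemma lpath_loop A C i j c : lpath A C i j i j c -> c = 0.
Proof.
suff h i' j' : lpath A C i j i' j' c -> (i' <= i)%N -> (j' <= j)%N -> c = 0.
  by move=> p; apply: h p _ _.
by case=> // {}i {}j {}i' {}j' c0 _ /lpath_le; lia.
Qed.

Lemma lpath_eq A C i j i' j' c c' :
  lpath A C i j i' j' c -> c = c' -> lpath A C i j i' j' c'.
Proof. by move=> p <-. Qed.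

Lemma lpath_cat A C i j i' j' i2 j2 c c' :
  lpath A C i j i' j' c -> lpath A C i' j' i2 j2 c' ->
  lpath A C i j i2 j2 (c + c').
Proof.
elim=> [i0 j0|i0 j0 i1 j1 c0 a _ ih|i0 j0 i1 j1 c0 a _ ih] h.
- by rewrite add0r.
- by rewrite -addrA; apply: lpath_right => //; apply: ih.
- by rewrite -addrA; apply: lpath_up => //; apply: ih.
Qed.

(** Differences of a potential telescope along a path, so only its values at the two end points
    enter. With [a = -1] this turns weights to be maximised into reduced costs to be minimised. *)
Lemma lpath_map A A' C C' (g h : nat -> nat) (a : R) (pot : nat -> nat -> R)
    i j i' j' c :
  (forall i j, A i j false -> [/\ A' (g i) (h j) false, g i.+1 = (g i).+1 &
     C' (g i) (h j) false = a * C i j false + pot i.+1 j - pot i j]) ->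
  (forall i j, A i j true -> [/\ A' (g i) (h j) true, h j.+1 = (h j).+1 &
     C' (g i) (h j) true = a * C i j true + pot i j.+1 - pot i j]) ->
  lpath A C i j i' j' c ->
  lpath A' C' (g i) (h j) (g i') (h j') (a * c + pot i' j' - pot i j).
Proof.
move=> hr hu; elim=> [i0 j0|i0 j0 i1 j1 c0 ha _ ih|i0 j0 i1 j1 c0 ha _ ih].
- by apply: lpath_eq (lpath_nil _ _ _ _) _; rewrite mulr0 add0r subrr.
- have [a' gE CE] := hr _ _ ha; rewrite gE in ih.
  by apply: lpath_eq (lpath_right a' ih) _; rewrite CE; ring.
- have [a' gE CE] := hu _ _ ha; rewrite gE in ih.
  by apply: lpath_eq (lpath_up a' ih) _; rewrite CE; ring.
Qed.

(** Makes the bounding box of a path available in the side conditions of [lpath_map], for instance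
    when coordinates are shifted by the truncated predecessor. *)
Lemma lpath_within A C i j i' j' c : lpath A C i j i' j' c ->
  lpath (fun a b d => [&& A a b d, (i <= a)%N, (j <= b)%N,
    (a + ~~ d <= i')%N & (b + d <= j')%N]) C i j i' j' c.
Proof.
have sub A1 A2 a b a' b' v : (forall i j d, A1 i j d -> A2 i j d) ->
    lpath A1 C a b a' b' v -> lpath A2 C a b a' b' v.
  move=> s; elim=> *; [exact: lpath_nil|apply: lpath_right|apply: lpath_up] => //;
  exact: s.
elim=> [i0 j0|i0 j0 i1 j1 c0 ha p ih|i0 j0 i1 j1 c0 ha p ih].
- exact: lpath_nil.
- have := lpath_le p => le_p.
  apply: lpath_right; first by rewrite ha; lia.
  by apply: sub ih => a b [] /and5P[-> ? ? ? ?]; lia.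
- have := lpath_le p => le_p.
  apply: lpath_up; first by rewrite ha; lia.
  by apply: sub ih => a b [] /and5P[-> ? ? ? ?]; lia.
Qed.

(* Same as [lpath_map], with the two coordinates exchanged. *)
Lemma lpath_map_tr A A' C C' (g h : nat -> nat) (a : R) (pot : nat -> nat -> R)
    i j i' j' c :
  (forall i j, A i j false -> [/\ A' (h j) (g i) true, g i.+1 = (g i).+1 &
     C' (h j) (g i) true = a * C i j false + pot i.+1 j - pot i j]) ->
  (forall i j, A i j true -> [/\ A' (h j) (g i) false, h j.+1 = (h j).+1 &
     C' (h j) (g i) false = a * C i j true + pot i j.+1 - pot i j]) ->
  lpath A C i j i' j' c ->
  lpath A' C' (h j) (g i) (h j') (g i') (a * c + pot i' j' - pot i j).
Proof.
move=> hr hu; elim=> [i0 j0|i0 j0 i1 j1 c0 ha _ ih|i0 j0 i1 j1 c0 ha _ ih].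
- by apply: lpath_eq (lpath_nil _ _ _ _) _; rewrite mulr0 add0r subrr.
- have [a' gE CE] := hr _ _ ha; rewrite gE in ih.
  by apply: lpath_eq (lpath_up a' ih) _; rewrite CE; ring.
- have [a' gE CE] := hu _ _ ha; rewrite gE in ih.
  by apply: lpath_eq (lpath_right a' ih) _; rewrite CE; ring.
Qed.

Lemma lpath_hline A C u v j :
  (u <= v)%N -> (forall i, (u <= i < v)%N -> A i j false) ->
  lpath A C u j v j (\sum_(u <= i < v) C i j false).
Proof.
move=> uv; elim: (v - u)%N {-2}u (leqnn (v - u)) uv => [|n ih] w.
  move=> le0 wv _; have -> : w = v by lia.
  by rewrite big_geq //; apply: lpath_nil.
move=> len wv hA; have [->|wv'] := eqVneq w v.
  by rewrite big_geq //; apply: lpath_nil.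
rewrite big_ltn; last lia.
apply: lpath_right; first by apply: hA; lia.
by apply: ih; [lia|lia|move=> i Hi; apply: hA; lia].
Qed.

Lemma lpath_vline A C u v i :
  (u <= v)%N -> (forall j, (u <= j < v)%N -> A i j true) ->
  lpath A C i u i v (\sum_(u <= j < v) C i j true).
Proof.
move=> uv hA.
have h := @lpath_hline (fun i j b => A j i (~~ b)) (fun i j b => C j i (~~ b))
  u v i uv hA.
(* The vertical line is the transpose of a horizontal one; the zero potential only brings its value
   into the shape required by [lpath_map_tr]. *)
have -> : \sum_(u <= j < v) C i j true =
    1 * \sum_(u <= j < v) C i j true + (fun=> fun=> 0 : R) v i - (fun=> fun=> 0) u i.
  by rewrite mul1r addr0 subr0.
by apply: (lpath_map_tr (g := id) (h := id) _ _ h) => a b;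
  rewrite /= mul1r addr0 subr0.
Qed.

End LatticePath.

(** * Exchanging successive rows of squares *)

Section ChainShifting.
Variable R : realDomainType.
Variables (e f : nat -> nat -> R) (ok : nat -> nat -> bool).
Hypothesis e_ge0 : forall i t, 0 <= e i t.
Hypothesis f_ge0 : forall i t, 0 <= f i t.
Hypothesis e_nok : forall i t, ~~ ok i t -> e i t = 0.
Hypothesis ef_ok : forall i t, ok i t -> e i t = 0 \/ f i t = 0.

(* Paths crossing [m] successive rows of unit squares, from row [t] on. In each row
   a path of the first kind travels along the bottom sides and then crosses,
   whereas a path of the second kind crosses and then travels along the top sides. *)
Fixpoint travel_cross (m t u v : nat) (c : R) : Prop :=
  if m is m'.+1 then
    exists w c', [/\ (u <= w)%N, ok w t, travel_cross m' t.+1 w v c' &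
      c = \sum_(u <= i < w) e i t + f w t + c']
  else u = v /\ c = 0.

Fixpoint cross_travel (m t u v : nat) (c : R) : Prop :=
  if m is m'.+1 then
    exists w c', [/\ (u <= w)%N, ok u t, cross_travel m' t.+1 w v c' &
      c = f u t + \sum_(u.+1 <= i < w.+1) e i t + c']
  else u = v /\ c = 0.

(** The upper rows are exchanged first. Their new path starts at some [w'] with [w <= w'], and row
    [t] is then exchanged with [w'] as its right end. *)
Lemma travel_cross_shift m t u v d c : (v <= d)%N -> travel_cross m t u v c ->
  exists u' c', [/\ (u <= u' <= d)%N, cross_travel m t u' d c' & c' <= c].
Proof.
move=> vd; elim: m t u c => [|m ih] t u c /=.
  by move=> [-> ->]; exists d, 0; split=> //; lia.
move=> [w [c' [uw okw /ih[w' [c2 [ww' h2 le2]]] ->]]].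
have [|u' [uu' oku' le']] := @row_exchange _ (e^~ t) (f^~ t) (ok^~ t) u w w'
  (e_ge0^~ t) (f_ge0^~ t) (fun i => @e_nok i t) (fun i => @ef_ok i t) _ okw; first lia.
exists u', (f u' t + \sum_(u'.+1 <= i < w'.+1) e i t + c2).
split; [lia| |exact: lerD].
by exists w', c2; split => //; lia.
Qed.

(** Here the lowest row is exchanged first; the remaining rows may then start further to the left,
    which is why [u] and [u'] are kept apart in the induction. *)
Lemma cross_travel_shift m t u u' d c : (u <= u' <= d)%N ->
  cross_travel m t u' d c ->
  exists v c', [/\ (v <= d)%N, travel_cross m t u v c' & c' <= c].
Proof.
elim: m t u u' c => [|m ih] t u u' c uu' /=.
  by move=> [_ ->]; exists u, 0; split=> //; lia.
move=> [w [c' [uw okw h ->]]].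
have [|v [uv okv le']] := @row_exchange_rev _ (e^~ t) (f^~ t) (ok^~ t) u u' w
  (e_ge0^~ t) (f_ge0^~ t) (fun i => @e_nok i t) (fun i => @ef_ok i t) _ okw; first lia.
have wd : (w <= d)%N.
  elim: m t.+1 w {uw le' uv ih} c' h => [|m ih] t' w c' /=; first by move=> [-> _].
  by move=> [w' [c2 [ww' _ /ih]]]; lia.
have [|v' [c2 [v'd h' le2]]] := ih t.+1 v w c' _ h; first lia.
exists v', (\sum_(u <= i < v) e i t + f v t + c2).
split => //; last exact: lerD.
by exists v, c2; split => //; lia.
Qed.

Lemma travel_cross_le m t u v c : travel_cross m t u v c -> (u <= v)%N.
Proof.
elim: m t u c => [|m ih] t u c /=; first by move=> [-> _].
by move=> [w' [c2 [ww' _ /ih]]]; lia.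
Qed.

Lemma cross_travel_le m t u v c : cross_travel m t u v c -> (u <= v)%N.
Proof.
elim: m t u c => [|m ih] t u c /=; first by move=> [-> _].
by move=> [w' [c2 [ww' _ /ih]]]; lia.
Qed.

Variables (A : nat -> nat -> bool -> bool) (C : nat -> nat -> bool -> R).

(** The steps are grouped row by row. Those along the top row [t + m] are dropped: they have
    nonnegative cost, and [v] may therefore lie to the left of [d]. *)
Lemma lpath_travel_cross m t u d c :
  (forall i j, A i j false -> C i j false = e i j \/
     j = (t + m)%N /\ C i j false = 0) ->
  (forall i j, A i j true -> (j < t + m)%N -> ok i j /\ C i j true = f i j) ->
  lpath A C u t d (t + m) c ->
  exists v c', [/\ (v <= d)%N, travel_cross m t u v c' & c' <= c].
Proof.
have [n tmn] : exists n, n = (t + m)%N by exists (t + m)%N.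
rewrite -tmn => hr hu p.
elim: p m tmn hr hu => [i j|i j i' j' c0 a _ ih|i j i' j' c0 a p ih] m tmn hr hu.
- have -> : m = 0%N by lia.
  by exists i, 0; split.
- have [v [c' [vd h le']]] := ih m tmn hr hu.
  case: m h hr hu ih tmn => [|m] /= h hr hu ih tmn.
    exists i, 0; split => //; first by have := h; lia.
    case: h => _ h; rewrite h in le'; apply: addr_ge0 => //.
    by have [->//|[_ ->]//] := hr _ _ a.
  case: h => [w [c2 [uw okw h ->]]] in le' *.
  exists v, (\sum_(i <= i < w) e i j + f w j + c2); split => //.
    by exists w, c2; split => //; lia.
  rewrite big_ltn //.
  have [->|[? _]] := hr _ _ a; last lia.
  by rewrite -!addrA lerD2l !addrA.
- have /andP[_ jj'] := lpath_le p.
  case: m hr hu tmn => [|m] hr hu tmn; first lia.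
  have [|v [c' [vd h le']]] := ih m _ hr hu; first lia.
  have [oki Ci] := hu _ _ a ltac:(lia).
  exists v, (f i j + c'); split => //; last by rewrite Ci lerD2l.
  by exists i, c'; split => //; rewrite big_geq // add0r.
Qed.

(** [S] is an invariant of the points reached. Steps along the top row are free, so the path can be
    prolonged from [v] to [d]. *)
Lemma travel_cross_lpath m t u v d c (S : nat -> nat -> bool) :
  (forall i j w, S i j -> ok w j -> (i <= w <= d)%N -> (j < t + m)%N ->
     [/\ S w j.+1, A w j true & C w j true = f w j]) ->
  (forall i j w, S i j -> ok w j -> (i < w <= d)%N -> (j < t + m)%N ->
     [/\ A i j false, C i j false = e i j & S i.+1 j]) ->
  (forall i, S i (t + m)%N -> (i < d)%N ->
     [/\ A i (t + m)%N false, C i (t + m)%N false = 0 & S i.+1 (t + m)%N]) ->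
  (v <= d)%N -> S u t -> travel_cross m t u v c -> lpath A C u t d (t + m) c.
Proof.
move=> hu hr hl vd.
elim: m t u c hu hr hl => [|m ih] t u c hu hr hl Su /=.
  move=> [uv ->]; rewrite -uv addn0 in vd hl *.
  have Si i : (u <= i <= d)%N -> S i t.
    elim: i => [|i ih] Hi; first by have -> : 0%N = u by lia.
    have [<-//|ui] := eqVneq u i.+1.
    by have [] // := hl i; [apply: ih; lia|lia].
  apply: lpath_eq (lpath_hline _ _ _) _ => // [i Hi|].
    by have [] // := hl i; [apply: Si; lia|lia].
  rewrite big_nat_cond big1 // => i /andP[Hi _].
  by have [] // := hl i; [apply: Si; lia|lia].
move=> [w [c' [uw okw h ->]]].
have wd := leq_trans (travel_cross_le h) vd.
have Si i : (u <= i <= w)%N -> S i t.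
  elim: i => [|i ih'] Hi; first by have -> : 0%N = u by lia.
  have [<-//|ui] := eqVneq u i.+1.
  by have [] // := hr i t w; [apply: ih'; lia|lia|lia].
have -> : \sum_(u <= i < w) e i t = \sum_(u <= i < w) C i t false.
  apply: eq_big_nat => i Hi.
  by have [] // := hr i t w; [apply: Si; lia|lia|lia].
rewrite -addrA; apply: lpath_cat.
  apply: lpath_hline => // i Hi.
  by have [] // := hr i t w; [apply: Si; lia|lia|lia].
have [|||Sw Aw <-] := hu w t w _ okw _; [by apply: Si; lia|lia|lia|].
apply: lpath_up => //.
rewrite addnS -addSn in hu hr hl *.
by apply: ih.
Qed.

(** In the application to x-paths, abscissa [i] stands for column [i + 1]. A horizontal step is
    charged to the square below it, hence the index [i.+1] of [e]; the initial run in row [t] lies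
    above none of the squares crossed and is dropped. *)
Lemma lpath_cross_travel m t u d c :
  (forall i j, A i j false -> (j = t /\ 0 <= C i j false) \/
     (exists j', j = j'.+1 /\ C i j false = e i.+1 j')) ->
  (forall i j, A i j true -> (j < t + m)%N -> ok i j /\ C i j true = f i j) ->
  lpath A C u t d (t + m) c ->
  exists u' c', [/\ (u <= u')%N, cross_travel m t u' d c' & c' <= c].
Proof.
move=> hr hu p.
(* The cost [c0] of the leading horizontal run is kept apart: in the induction that run becomes the
   travelling part of the preceding row. *)
suff [t' [c0 [c1 [tt' h E]]]] : exists u' c0 c1, [/\ (u <= u')%N,
   cross_travel m t u' d c1 & c = c0 + c1 /\
     (forall t0, t = t0.+1 -> (forall i, A i t false ->
        C i t false = e i.+1 t0) -> c0 = \sum_(u.+1 <= i < u'.+1) e i t0) /\ 0 <= c0].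
  exists t', c1; split=> //; case: E => -> [_ c0_ge0]; lra.
have hr' i j : A i j false -> 0 <= C i j false.
  by move=> /hr[[]|[j' [_ ->]]].
have : forall i j, A i j false -> (t < j)%N ->
    exists j', j = j'.+1 /\ C i j false = e i.+1 j'.
  by move=> i j /hr[[->]|//]; rewrite ltnn.
have [n tmn] : exists n, n = (t + m)%N by exists (t + m)%N.
rewrite -tmn in hu p * => {}hr.
elim: p m tmn hr hu => [i j|i j i' j' c0 a _ ih|i j i' j' c0 a p ih] m tmn hr hu.
- have -> : m = 0%N by lia.
  by exists i, 0, 0; split => //; rewrite addr0; split => //; split=> // ? _ _; rewrite big_geq.
- have [u' [c1 [c2 [iu h [-> [E c1_ge0]]]]]] := ih m tmn hr hu.
  exists u', (C i j false + c1), c2; split => //; first lia.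
  split; [by rewrite addrA|split; last by rewrite addr_ge0 ?hr'].
  by move=> t0 jt hC; rewrite [RHS]big_ltn //; rewrite -(E _ jt) // hC.
- have /andP[_ jj'] := lpath_le p.
  case: m hr hu tmn => [|m] hr hu tmn; first lia.
  have [||u' [c1 [c2 [iu h [-> [E c1_ge0]]]]]] := ih m _ _ hu; first lia.
    by move=> i0 j0 a0 lt0; apply: hr => //; lia.
  have [oki Ci] := hu _ _ a ltac:(lia).
  exists i, 0, (C i j true + (c1 + c2)); split => //.
    exists u', c2; split => //; rewrite Ci (E j erefl) ?addrA // => i0 a0.
    by have [j0 [[<-]]] := hr _ _ a0 (ltnSn _).
  by rewrite add0r; split => //; split => // t0 _ _; rewrite big_geq.
Qed.

(** The alternative in the second hypothesis tells where the run in row [j + 1] ends: at the next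
    crossing, which is admissible, or at [d] in the top row. *)
Lemma cross_travel_lpath m t u d c (S : nat -> nat -> bool) :
  (forall i j, S i j -> ok i j -> (j < t + m)%N ->
     [/\ S i j.+1, A i j true & C i j true = f i j]) ->
  (forall i j w, S i j.+1 -> (i < w <= d)%N -> (j < t + m)%N ->
      (if j.+1 == (t + m)%N then w == d else ok w j.+1) ->
     [/\ S i.+1 j.+1, A i j.+1 false & C i j.+1 false = e i.+1 j]) ->
  S u t -> cross_travel m t u d c -> lpath A C u t d (t + m) c.
Proof.
elim: m t u c => [|m ih] t u c hu hr Su /=.
  by move=> [-> ->]; rewrite addn0; apply: lpath_nil.
move=> [w [c' [uw oku h ->]]].
have [|Su1 Au <-] := hu _ _ Su oku; first lia.
have wd := cross_travel_le h.
rewrite -addrA; apply: lpath_up => //.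
have hw : if t.+1 == (t + m.+1)%N then w == d else ok w t.+1.
  case: m h {ih hu hr} => [|m] /=; first by case=> -> _; rewrite addn1 eqxx.
  by move=> [w' [c2 [_ okw _ _]]]; have -> : (t.+1 == t + m.+2)%N = false by lia.
have Si i : (u <= i <= w)%N -> S i t.+1.
  elim: i => [|i ih'] Hi; first by have -> : 0%N = u by lia.
  have [<-//|ui] := eqVneq u i.+1.
  by have [] // := hr i t w; [apply: ih'; lia|lia|lia].
have Ai i : (u <= i < w)%N -> A i t.+1 false /\ C i t.+1 false = e i.+1 t.
  by move=> Hi; have [] // := hr i t w; [apply: Si; lia|lia|lia].
apply: lpath_cat; last first.
  rewrite addnS -addSn in hu hr *.
  by apply: ih hu hr (Si w _) h; lia.
have -> : \sum_(u.+1 <= i < w.+1) e i t = \sum_(u <= i < w) C i t.+1 false.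
  rewrite big_add1 /=; apply: eq_big_nat => i Hi.
  by have [] := Ai i Hi.
by apply: lpath_hline => // i Hi; have [] := Ai i Hi.
Qed.

End ChainShifting.

(** * Shifting paths in M *)

Definition weight (R : realDomainType) (w : nat -> nat -> R) (i j : nat) (b : bool) : R :=
  if b then w i j.+1 else w i.+1 j.

Definition edge (S : nat -> nat -> bool) (i j : nat) (b : bool) : bool :=
  S i j && (if b then S i j.+1 else S i.+1 j).

(* The value of a path leaves out the weight of its starting point. *)
Definition wpath (R : realDomainType) (S : nat -> nat -> bool)
    (w : nat -> nat -> R) :=
  lpath (edge S) (weight w).

Lemma wpath_map (R : realDomainType) (S S' : nat -> nat -> bool)
    (w w' : nat -> nat -> R) (g h : nat -> nat) i j i' j' v :
  (forall a b, S a b -> (i <= a <= i')%N -> (j <= b <= j')%N ->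
     S' (g a) (h b) /\ w' (g a) (h b) = w a b) ->
  (forall a, (i <= a)%N -> g a.+1 = (g a).+1) ->
  (forall b, (j <= b)%N -> h b.+1 = (h b).+1) ->
  wpath S w i j i' j' v -> wpath S' w' (g i) (h j) (g i') (h j') v.
Proof.
move=> SS gS hS /lpath_within p.
have -> : v = 1 * v + (fun=> fun=> 0 : R) i' j' - (fun=> fun=> 0 : R) i j.
  by rewrite mul1r addr0 subr0.
apply: (lpath_map _ _ p) => a b /and5P[/andP[m1 m2] /= ia jb ai bj].
  have [|||S1 _] := SS a b; rewrite ?m1 //; try lia.
  have [|||S2 w2] := SS a.+1 b; rewrite ?m2 //; try lia.
  by rewrite /edge S1 -gS // S2 w2 mul1r addr0 subr0.
have [|||S1 _] := SS a b; rewrite ?m1 //; try lia.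
have [|||S2 w2] := SS a b.+1; rewrite ?m2 //; try lia.
by rewrite /edge S1 -hS // S2 w2 mul1r addr0 subr0.
Qed.

Lemma wpath_sub (R : realDomainType) (S S' : nat -> nat -> bool)
    (w : nat -> nat -> R) i j i' j' v :
  (forall a b, S a b -> (i <= a <= i')%N -> (j <= b <= j')%N -> S' a b) ->
  wpath S w i j i' j' v -> wpath S' w i j i' j' v.
Proof.
by move=> SS; apply: (wpath_map (g := id) (h := id)) => // a b ? ? ?; split => //; apply: SS.
Qed.

Lemma wpath_end (R : realDomainType) (S : nat -> nat -> bool) (w : nat -> nat -> R)
    i j i' j' v :
  S i j -> wpath S w i j i' j' v -> S i' j'.
Proof. by move=> + p; elim: p => // ? ? ? ? ? /andP[_ m] _ ih _; apply: ih. Qed.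

Section ShiftInM.
Variable R : realDomainType.
Variables (r k : nat).
Hypothesis k_gt0 : (0 < k)%N.
Hypothesis k_lt_r : (k < r)%N.

Definition inM (i j : nat) : bool :=
  [&& (k <= i)%N, (i < r + j)%N, (1 <= j)%N & (j <= k.+1)%N].

Definition onL (i j : nat) : bool := i.+1 == (r + j)%N.

Definition inMnL (i j : nat) : bool := inM i j && ~~ onL i j.

(** The largest value of [y] on the points covered in M: in column [k] only the point below is left,
    in row 1 and on L only the point to the left. *)
Definition low (y : nat -> nat -> R) (i j : nat) : R :=
  if i == k then y i j.-1 else if (j == 1%N) || onL i j then y i.-1 j
  else Num.max (y i.-1 j) (y i j.-1).

(** The smallest value of [y] on the upper covers in M: in the top row only the point to the right
    is left, on the rest of L only the point above. *)
Definition up (y : nat -> nat -> R) (i j : nat) : R :=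
  if j == k.+1 then y i.+1 j else if onL i j then y i j.+1
  else Num.min (y i.+1 j) (y i j.+1).

Variables x y z : nat -> nat -> R.
Hypothesis x_y : forall i j, inM i j -> (i, j) != (k, 1%N) -> x i j = y i j - low y i j.
Hypothesis z_y : forall i j, inM i j -> (i, j) != ((r + k)%N, k.+1) ->
  z i j = up y i j - y i j.

(** The lower right corner of the unit square at (i, j) does not lie beyond L. *)
Let ok (i j : nat) : bool := (i.+1 < r + j)%N.

(* With these junk values, the reduced costs of the steps along the boundary of M
   are given by the same formulas as in the interior. *)
Let e i j : R :=
  if [&& ok i j, (0 < j)%N & (j <= k)%N] then Num.max 0 (y i.+1 j - y i j.+1) else 0.
Let f i j : R :=
  if ok i j && (k <= i)%N then Num.max 0 (y i j.+1 - y i.+1 j) else 0.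

Let e_ge0 i j : 0 <= e i j.
Proof. by rewrite /e; case: ifP => // _; rewrite maxEle; case: ifP. Qed.

Let f_ge0 i j : 0 <= f i j.
Proof. by rewrite /f; case: ifP => // _; rewrite maxEle; case: ifP. Qed.

Let e_nok i j : ~~ ok i j -> e i j = 0.
Proof. by rewrite /e => /negbTE->. Qed.

Let f_nok i j : ~~ ok i j -> f i j = 0.
Proof. by rewrite /f => /negbTE->. Qed.

Let ef_ok i j : ok i j -> e i j = 0 \/ f i j = 0.
Proof.
rewrite /e /f => ->; case: (_ && _); last by left.
case: (k <= i)%N; last by right.
by rewrite !maxEle; case: ifP => h1; case: ifP => h2; [right|right|left|left]; lra.
Qed.

Let fe_ok i j : ok i j -> f i j = 0 \/ e i j = 0.
Proof. by move=> /ef_ok[]; [right|left]. Qed.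

(* The reduced costs of the steps of a z-path and of an x-path. *)
Let z_right i j : inM i j -> inM i.+1 j ->
  y i.+1 j - y i j - z i j = e i j.
Proof.
rewrite /inM => m m'; rewrite z_y ?xpair_eqE; [|exact: m|lia].
rewrite /up /e /onL /ok.
have -> : (i.+1 == (r + j)%N) = false by lia.
have -> : [&& (i.+1 < r + j)%N, (0 < j)%N & (j <= k)%N] = (j != k.+1) by lia.
case: eqVneq => _ /=; first by ring.
by rewrite maxEle minEle; case: ifP; case: ifP => *; lra.
Qed.

Let z_up i j : inM i j -> inM i j.+1 -> y i j.+1 - y i j - z i j = f i j.
Proof.
rewrite /inM => m m'; rewrite z_y; [|exact: m|rewrite xpair_eqE; lia].
rewrite /up /f /onL /ok.
have -> : (j == k.+1) = false by lia.
have [->|nl] := eqVneq i.+1 (r + j)%N; first by rewrite ltnn; ring.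
have -> : (i.+1 < r + j)%N && (k <= i)%N by lia.
by rewrite maxEle minEle; case: ifP; case: ifP => *; lra.
Qed.

Let x_right i j : inM i j -> inM i.+1 j ->
  y i.+1 j - y i j - x i.+1 j = e i j.-1.
Proof.
rewrite /inM => m m'; rewrite x_y; [|rewrite /inM; lia|rewrite xpair_eqE; lia].
rewrite /low /e /onL /ok.
have -> : (i.+1 == k) = false by lia.
have [->|j1] /= := eqVneq j 1%N; first by rewrite andbF; ring.
rewrite (_ : j.-1.+1 = j); last lia.
have -> : [&& (i.+1 < r + j.-1)%N, (0 < j.-1)%N & (j.-1 <= k)%N] =
  (i.+2 != r + j)%N by lia.
case: eqVneq => _ /=; first by ring.
by rewrite !maxEle; case: ifP; case: ifP => *; lra.
Qed.

Let x_up i j : inM i j -> inM i j.+1 ->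
  y i j.+1 - y i j - x i j.+1 = f i.-1 j.
Proof.
rewrite /inM => m m'; rewrite x_y; [|rewrite /inM; lia|rewrite xpair_eqE; lia].
rewrite /low /f /onL /ok /=.
have [->|ik] := eqVneq i k.
  have -> : (k <= k.-1)%N = false by lia.
  by rewrite andbF; ring.
have -> : (j.+1 == 1%N) || (i.+1 == (r + j.+1)%N) = false by lia.
rewrite (_ : i.-1.+1 = i); last lia.
have -> : (i < r + j)%N && (k <= i.-1)%N by lia.
by rewrite !maxEle; case: ifP; case: ifP => *; lra.
Qed.

(** A path is weighted by the end points of its steps, whereas the reduced costs of z involve their
    starting points; hence the potential is y + z instead of y. *)
Let zy i j := z i j + y i j.

Let Hz i j b : R := if b then f i j else e i j.
(** Shifted coordinates for x-paths: [Hx i j] is the cost of a step out of (i + 1, j), and [Vx p t],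
    with the coordinates exchanged, that of a step out of (t, p + 1). *)
Let Vx p t b : R := if b then e t p else f t.-1 p.+1.
Let Hx i j b : R := if b then f i j else e i.+1 j.-1.
Let Ax i j b := (k <= i)%N && edge inM i.+1 j b.

Let HxE i j b : Ax i j b ->
  Hx i j b = - weight x i.+1 j b + (if b then y i.+1 j.+1 else y i.+2 j) - y i.+1 j.
Proof.
rewrite /Hx; case: b => /andP[ki /andP[m1 m2]].
  by rewrite -(x_up m1 m2) /=; ring.
by rewrite /= -(x_right m1 m2); ring.
Qed.

Let HzE i j b : edge inM i j b ->
  Hz i j b = - weight z i j b + (if b then zy i j.+1 else zy i.+1 j) - zy i j.
Proof.
rewrite /Hz; case: b => /andP[m1 m2].
  by rewrite -(z_up m1 m2) /= /zy; ring.
by rewrite -(z_right m1 m2) /= /zy; ring.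
Qed.

Let edge_nL i j b : edge inMnL i j b -> edge inM i j b.
Proof. by rewrite /edge /inMnL; case: b; lia. Qed.

(** Under the second hypothesis (c, b) is the only point covered by (c + 1, b) in M. This makes the
    end terms of the x-path and of the z-path agree in the horizontal shifts. *)
Let x_start c b : inMnL c b -> (b = 1%N \/ c.+2 = (r + b)%N) ->
  y c.+1 b - x c.+1 b = y c b.
Proof.
rewrite /inMnL /inM /onL => Mcb bc.
rewrite x_y; [|rewrite /inM; lia|rewrite xpair_eqE; lia].
rewrite /low /onL; have -> : (c.+1 == k) = false by lia.
have -> : (b == 1%N) || (c.+2 == (r + b)%N) by lia.
by rewrite /=; ring.
Qed.

Let z_end d : (k <= d)%N -> (d < r + k)%N -> z d k.+1 = y d.+1 k.+1 - y d k.+1.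
Proof.
move=> kd dk; rewrite z_y; [|rewrite /inM; lia|rewrite xpair_eqE; lia].
by rewrite /up eqxx.
Qed.

(** Both total weights equal y(d + 1, k + 1) - y(c, b) minus a sum of reduced costs, so it suffices
    to exchange the rows b, ..., k. *)
Lemma horizontal_shift_zx c b d v :
  inMnL c b -> (d < r + k)%N -> (b = 1%N \/ c.+2 = (r + b)%N) ->
  wpath inMnL z c b d k.+1 v ->
  exists v', wpath inM x c.+1 b d.+1 k.+1 v' /\ z c b + v <= x c.+1 b + v'.
Proof.
move=> Mcb dk bc p.
have /andP[cd bk] := lpath_le p.
have [b_gt0 kc] : (0 < b)%N /\ (k <= c)%N by move: Mcb; rewrite /inMnL /inM; lia.
have {}p : lpath (edge inMnL) Hz c b d (b + (k.+1 - b))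
    (-1 * v + zy d k.+1 - zy c b).
  rewrite subnKC //; apply: (lpath_map (g := id) (h := id) _ _ p) => i j a; split => //;
  by rewrite (HzE (edge_nL a)) mulN1r.
have [||v1 [c1 [v1d tc c1_le]]] :=
    lpath_travel_cross (f := f) (ok := ok) e_ge0 _ _ p.
- by move=> i j a; left.
- move=> i j /andP[/andP[m1 n1] /andP[m2 n2]] _; split => //.
  by move: m1 n1; rewrite /ok /inM /onL; lia.
have [u [c2 [cud ct c2_le]]] :=
  travel_cross_shift e_ge0 f_ge0 e_nok ef_ok v1d tc.
have okL : (b <= k)%N -> ok u b.
  by case: (k.+1 - b)%N (subnKC bk) ct => [|m]; [lia|move=> _ /= [w [c' []]]].
have q : lpath Ax Hx c b d (b + (k.+1 - b)) c2.
  have cbM : inM c b by case/andP: Mcb.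
  (* Before its first crossing the new path has to run from [c] to [u] in row [b]. This is free in
     row 1, where [e] takes its junk value 0, and the run is empty next to L. *)
  have q0 : lpath Ax Hx c b u b 0.
    case: bc => [b1|cb]; last first.
      have -> : u = c.
        case: (ltnP k b) => bk'.
          by move: Mcb dk; rewrite /inMnL /inM /onL; lia.
        by move: okL; rewrite /ok; lia.
      exact: lpath_nil.
    apply: lpath_eq (lpath_hline _ _ _) _; first lia.
      by move=> i Hi; move: okL cbM; rewrite /Ax /edge /inM /ok b1; lia.
    by rewrite big1 // => i _; rewrite /Hx /e b1 andbF.
  rewrite -[c2]add0r; apply: lpath_cat q0 _.
  apply: (cross_travel_lpath (S := fun i j => (k <= i)%N && inM i.+1 j) _ _ _ ct).
  + by move=> i j; rewrite /Ax /Hx /edge /inM /ok => *; split => //; lia.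
  + move=> i j w; rewrite /Ax /Hx /edge /inM /ok /= => m1 iw jk.
    by case: ifP => jE => [/eqP wE|okw]; split => //; lia.
  + by move: okL cbM; rewrite /inM /ok; lia.
rewrite (subnKC bk) in q.
exists (-1 * c2 + y d.+1 k.+1 - y c.+1 b); split.
  apply: (lpath_map (g := succn) (h := id) (pot := fun i j => y i.+1 j) _ _ q) =>
  i j a; split => //; by [case/andP: a|rewrite (HxE a) /=; ring].
have := x_start Mcb bc.
move: c2_le c1_le; rewrite /zy (z_end (leq_trans kc cd) dk).
by set X := x _ _; set Z := z _ _; lra.
Qed.

(** The end terms agree as before, and the rows are exchanged in the opposite direction. *)
Lemma horizontal_shift_xz c b d v :
  inMnL c b -> (d < r + k)%N -> (b = 1%N \/ c.+2 = (r + b)%N) ->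
  wpath inM x c.+1 b d.+1 k.+1 v ->
  exists v', wpath inMnL z c b d k.+1 v' /\ x c.+1 b + v <= z c b + v'.
Proof.
move=> Mcb dk bc /lpath_within p.
have /andP[cd bk] := lpath_le p.
have [b_gt0 kc] : (0 < b)%N /\ (k <= c)%N by move: Mcb; rewrite /inMnL /inM; lia.
have {}p : lpath (fun i j d => Ax i j d && (c <= i)%N) Hx c b d (b + (k.+1 - b))
    (-1 * v + y d.+1 k.+1 - y c.+1 b).
  rewrite subnKC //.
  apply: (lpath_map (g := predn) (h := id) _ _ p) => i j /and5P[a ci bj _ _].
    have a' : Ax i.-1 j false by rewrite /Ax (_ : i.-1.+1 = i) ?a; lia.
    split; [by rewrite a'; lia|lia|].
    by rewrite (HxE a') (_ : i.-1.+1 = i); [rewrite mulN1r|lia].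
  have a' : Ax i.-1 j true by rewrite /Ax (_ : i.-1.+1 = i) ?a; lia.
  split => //; [by rewrite a'; lia|].
  by rewrite (HxE a') (_ : i.-1.+1 = i); [rewrite mulN1r|lia].
have [||u [c1 [cu ct c1_le]]] := lpath_cross_travel (f := f) (ok := ok) e_ge0 _ _ p.
- move=> i j /andP[/andP[ki /andP[m1 m2]] _]; right; exists j.-1; split => //.
  by move: m1; rewrite /inM; lia.
- by move=> i j /andP[/andP[ki /andP[m1 m2]] _] _; split => //; move: m1; rewrite /ok /inM; lia.
have ud := cross_travel_le ct.
have [|v1 [c2 [v1d tc c2_le]]] :=
  cross_travel_shift (u := c) (d := d) e_ge0 f_ge0 e_nok ef_ok _ ct; first lia.
have q : lpath (edge inMnL) Hz c b d (b + (k.+1 - b)) c2.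
  apply: (travel_cross_lpath (S := inMnL) _ _ _ _ _ tc) => //.
  + by move=> i j w; rewrite /Hz /edge /inMnL /inM /onL /ok => *; split => //; lia.
  + by move=> i j w; rewrite /Hz /edge /inMnL /inM /onL /ok => *; split => //; lia.
  + move=> i; rewrite /Hz /edge /inMnL /inM /onL /ok /e subnKC // => *; split => //; try lia.
    by rewrite ltnn !andbF.
rewrite (subnKC bk) in q.
exists (-1 * c2 + zy d k.+1 - zy c b); split.
  apply: (lpath_map (g := id) (h := id) _ _ q) => i j a; split => //;
  by rewrite (HzE (edge_nL a)); ring.
have := x_start Mcb bc.
move: c2_le c1_le; rewrite /zy (z_end (leq_trans kc (leq_trans cu ud)) dk).
by set X := x _ _; set Z := z _ _; lra.
Qed.

Let VxE i j b : edge inM i j.+1 b ->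
  Vx j i (~~ b) =
  - weight x i j.+1 b + (if b then y i j.+2 else y i.+1 j.+1) - y i j.+1.
Proof.
rewrite /Vx; case: b => /andP[m1 m2] /=; first by rewrite -(x_up m1 m2) /=; ring.
by rewrite -[j]/(j.+1.-1) -(x_right m1 m2) /=; ring.
Qed.

Let x_left j : (0 < j)%N -> (j <= k)%N -> x k j.+1 = y k j.+1 - y k j.
Proof.
move=> j0 jk; rewrite x_y; [|rewrite /inM; lia|rewrite xpair_eqE; lia].
by rewrite /low eqxx.
Qed.

Let z_L n a : n.+1 = (r + a)%N -> (0 < a)%N -> (a <= k)%N ->
  z n a = y n a.+1 - y n a.
Proof.
move=> nE a0 ak; rewrite z_y; [|rewrite /inM; lia|rewrite xpair_eqE; lia].
by rewrite /up /onL nE eqxx; have -> : (a == k.+1) = false by lia.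
Qed.

(** Transposed form of the horizontal shift, with [e] and [f] interchanged. Both total weights are
    y(n, a + 1) - y(k, j) minus reduced costs, since (n, a) lies on L and has (n, a + 1) as its only
    upper cover. The x-path moves up column [k] at no cost, because [f] vanishes at [k - 1]. *)
Lemma vertical_shift_zx j n a v : (0 < j)%N -> (a <= k)%N -> n.+1 = (r + a)%N ->
  wpath inM z k j n a v ->
  exists v', wpath inMnL x k j.+1 n a.+1 v' /\ z k j + v <= x k j.+1 + v'.
Proof.
move=> j0 ak nE /lpath_within p.
have /andP[kn ja] := lpath_le p.
have {}p : lpath (fun p t b => edge inM t p (~~ b)) (fun p t b => Hz t p (~~ b)) j k a
    (k + (n - k)) (-1 * v + zy n a - zy k j).
  rewrite subnKC //.
  by apply: (lpath_map_tr (g := id) (h := id) _ _ p) => i0 j1 /and5P[m _ _ _ _];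
    split => //; rewrite (HzE m) mulN1r.
have [||v1 [c1 [v1d tc c1_le]]] := lpath_travel_cross
    (e := fun p t => f t p) (f := fun p t => e t p) (ok := fun p t => ok t p)
    (fun p t => f_ge0 t p) _ _ p.
- by move=> i0 j1 _; left.
- by move=> i0 j1 /andP[m1 m2] _; split => //; move: m2; rewrite /inM /ok; lia.
have [u [c2 [jua ct c2_le]]] := travel_cross_shift (fun p t => f_ge0 t p)
  (fun p t => e_ge0 t p) (fun p t => @f_nok t p) (fun p t => @fe_ok t p) v1d tc.
have okL : ok k u.
  case: (n - k)%N (subnKC kn) ct => [|m]; first lia.
  by move=> _ /= [w [c' []]].
have q : lpath (fun p t b => edge inMnL t p.+1 (~~ b)) Vx j k a
    (k + (n - k)) c2.
  rewrite -[c2]add0r; apply: (@lpath_cat _ _ _ _ _ u k).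
    apply: lpath_eq (lpath_hline _ _ _) _; first lia.
      by move=> i Hi; move: okL; rewrite /edge /inMnL /inM /onL /ok /=; lia.
    rewrite big1 // => i _; rewrite /Vx /f.
    have -> : (k <= k.-1)%N = false by lia.
    by rewrite andbF.
  apply: (cross_travel_lpath (S := fun p t => inMnL t p.+1) _ _ _ ct).
  + by move=> i0 j1; rewrite /Vx /edge /inMnL /inM /onL /ok /= => *; split => //; lia.
  + move=> i0 j1 w; rewrite /Vx /edge /inMnL /inM /onL /ok /= => m1 iw jk.
    by case: ifP => jE => [/eqP wE|okw]; split => //; lia.
  + by move: okL; rewrite /inMnL /inM /onL /ok; lia.
rewrite (subnKC kn) in q.
exists (-1 * c2 + y n a.+1 - y k j.+1); split.
  apply: (lpath_map_tr (g := succn) (h := id) (pot := fun p t => y t p.+1) _ _ q) =>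
    p0 t0 m; split => //; first by rewrite (VxE (edge_nL m)) /=; ring.
  by rewrite (VxE (edge_nL m)) /=; ring.
have := x_left j0 (leq_trans ja ak).
have a0 := leq_trans j0 ja.
move: c2_le c1_le; rewrite /zy (z_L nE a0 ak).
by set X := x _ _; set Z := z _ _; lra.
Qed.

Lemma vertical_shift_xz j n a v : (0 < j)%N -> (a <= k)%N -> n.+1 = (r + a)%N ->
  wpath inMnL x k j.+1 n a.+1 v ->
  exists v', wpath inM z k j n a v' /\ x k j.+1 + v <= z k j + v'.
Proof.
move=> j0 ak nE /lpath_within p.
have /andP[kn ja] := lpath_le p.
have {}p : lpath (fun p t b => edge inMnL t p.+1 (~~ b)) Vx j k a
    (k + (n - k)) (-1 * v + y n a.+1 - y k j.+1).
  rewrite subnKC //.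
  apply: (lpath_map_tr (g := id) (h := predn) _ _ p) => i0 j1 /and5P[m _ jj _ _].
    have jE : j1.-1.+1 = j1 by lia.
    have m' : edge inMnL i0 j1.-1.+1 false by rewrite jE.
    by split => //; rewrite (VxE (edge_nL m')) jE mulN1r.
  have jE : j1.-1.+1 = j1 by lia.
  have m' : edge inMnL i0 j1.-1.+1 true by rewrite jE.
  by split => //; rewrite (VxE (edge_nL m')) jE mulN1r.
have [||u [c1 [ju ct c1_le]]] := lpath_cross_travel
    (e := fun p t => f t p) (f := fun p t => e t p) (ok := fun p t => ok t p)
    (fun p t => f_ge0 t p) _ _ p.
- move=> p0 t0 m; right; exists t0.-1; split => //.
  by move: m; rewrite /edge /inMnL /inM; lia.
- by move=> p0 t0 m _; split => //; move: m; rewrite /edge /inMnL /inM /onL /ok /=; lia.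
have ua := cross_travel_le ct.
have [|v1 [c2 [v1d tc c2_le]]] :=
  cross_travel_shift (u := j) (d := a) (fun p t => f_ge0 t p)
  (fun p t => e_ge0 t p) (fun p t => @f_nok t p) (fun p t => @fe_ok t p) _ ct; first lia.
have q : lpath (fun p t b => edge inM t p (~~ b)) (fun p t b => Hz t p (~~ b)) j k a
    (k + (n - k)) c2.
  apply: (travel_cross_lpath (S := fun p t => inM t p) _ _ _ _ _ tc) => //.
  + by move=> i j1 w; rewrite /Hz /edge /inM /ok /= => *; split => //; lia.
  + by move=> i j1 w; rewrite /Hz /edge /inM /ok /= => *; split => //; lia.
  + move=> i; rewrite subnKC // /Hz /edge /inM /= => m ia; split.
    * lia.
    * by apply: f_nok; rewrite /ok; lia.
    * lia.
  + by rewrite /inM; lia.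
rewrite (subnKC kn) in q.
exists (-1 * c2 + zy n a - zy k j); split.
  apply: (lpath_map_tr (g := id) (h := id) (pot := fun p t => zy t p) _ _ q) =>
    p0 t0 m; split => //; by rewrite (HzE m) /=; ring.
have := x_left j0 (leq_trans (ja : (j <= a)%N) ak).
have a0 : (0 < a)%N := leq_trans j0 (ja : (j <= a)%N).
move: c2_le c1_le; rewrite /zy (z_L nE a0 ak).
by set X := x _ _; set Z := z _ _; lra.
Qed.

(** From a point of L a path in M can only go up, so right after its last point (n, a) of L it
    visits (n, a + 1). *)
Lemma wpath_last_touch (w : nat -> nat -> R) i j i' j' v :
  ~~ onL i' j' -> wpath inM w i j i' j' v ->
  ~~ onL i j /\ wpath inMnL w i j i' j' v \/
  exists n a v1 v2, [/\ n.+1 = (r + a)%N, wpath inM w i j n a v1,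
    wpath inMnL w n a.+1 i' j' v2 & v = v1 + w n a.+1 + v2].
Proof.
move=> nL' p.
elim: p nL' => {i j i' j' v} [i j|i j i' j' v a p ih|i j i' j' v a p ih] nL'.
- by left; split => //; apply: lpath_nil.
- have [[nL q]|[n [b [v1 [v2 [nb p1 p2 ->]]]]]] := ih nL'.
    have nLi : ~~ onL i j by move: a; rewrite /edge /inM /onL /=; lia.
    left; split => //; apply: lpath_right q.
    by move: a; rewrite /edge /inMnL nL nLi !andbT.
  right; exists n, b, (w i.+1 j + v1), v2; split => //; last by rewrite /weight; ring.
  exact: lpath_right p1.
- have [[nL q]|[n [b [v1 [v2 [nb p1 p2 ->]]]]]] := ih nL'.
    have [Li|nLi] := boolP (onL i j); last first.
      left; split => //; apply: lpath_up q.
      by move: a; rewrite /edge /inMnL nL nLi !andbT.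
    right; exists i, j, 0, v; split => //; [exact/eqP|exact: lpath_nil|].
    by rewrite add0r.
  right; exists n, b, (w i j.+1 + v1), v2; split => //; last by rewrite /weight; ring.
  exact: lpath_up p1.
Qed.

(** L can only be entered by a step to the right, so the first point (n + 1, a + 1) of L is reached
    from (n, a + 1). *)
Lemma wpath_first_touch (w : nat -> nat -> R) i j i' j' v :
  ~~ onL i j -> wpath inM w i j i' j' v ->
  ~~ onL i' j' \/
  exists n a v1 v2, [/\ n.+1 = (r + a)%N, wpath inMnL w i j n a.+1 v1,
    wpath inM w n.+1 a.+1 i' j' v2 & v = v1 + w n.+1 a.+1 + v2].
Proof.
move=> nL p.
elim: p nL => {i j i' j' v} [i j|i j i' j' v a p ih|i j i' j' v a p ih] nL.
- by left.
- have [Li|nLi] := boolP (onL i.+1 j).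
    right; exists i, j.-1, 0, v.
    have jE : j.-1.+1 = j by move: a; rewrite /edge /inM; lia.
    rewrite jE; split => //; [by move: Li; rewrite /onL; lia|exact: lpath_nil|].
    by rewrite add0r.
  have [nL'|[n [b [v1 [v2 [nb p1 p2 ->]]]]]] := ih nLi; first by left.
  right; exists n, b, (w i.+1 j + v1), v2; split => //; last by rewrite /weight; ring.
  by apply: lpath_right p1; move: a; rewrite /edge /inMnL nL nLi !andbT.
- have nLi : ~~ onL i j.+1 by move: a; rewrite /edge /inM /onL; lia.
  have [nL'|[n [b [v1 [v2 [nb p1 p2 ->]]]]]] := ih nLi; first by left.
  right; exists n, b, (w i j.+1 + v1), v2; split => //; last by rewrite /weight; ring.
  by apply: lpath_up p1; move: a; rewrite /edge /inMnL nL nLi !andbT.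
Qed.

Lemma nL_sub w i j i' j' (v : R) : wpath inMnL w i j i' j' v -> wpath inM w i j i' j' v.
Proof. by apply: wpath_sub => a b /andP[]. Qed.

(* The last point (n, a) of L on the z-path corresponds to the first point
   (n + 1, a + 1) of L on the x-path. *)
Lemma touching_shift_zx j n0 a0 i v1 v2 :
  (0 < j)%N -> n0.+1 = (r + a0)%N -> (i < r + k)%N ->
  wpath inM z k j n0 a0 v1 -> wpath inM z n0 a0 i k.+1 v2 ->
  exists n a u1 u2, [/\ n.+1 = (r + a)%N, wpath inM x k j.+1 n a u1,
    wpath inM x n a i.+1 k.+1 u2 &
    z k j + v1 + v2 <= x k j.+1 + u1 + u2].
Proof.
move=> j0 nL ik p1 p2.
have nLi : ~~ onL i k.+1 by rewrite /onL; lia.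
have [[/eqP//]|[n [a [u1 [u2 [na q1 q2 ->]]]]]] := wpath_last_touch nLi p2.
have /andP[ni ak] := lpath_le q2.
have /andP[kn ja] := lpath_le (lpath_cat p1 q1).
have [v1' [r1 le1]] := vertical_shift_zx j0 ak na (lpath_cat p1 q1).
have [||v2' [r2 le2]] := horizontal_shift_zx _ ik _ q2.
- by rewrite /inMnL /inM /onL; lia.
- by right; lia.
exists n.+1, a.+1, (v1' + x n.+1 a.+1), v2'; split => //; first lia.
  apply: lpath_cat (nL_sub r1) _; rewrite -[x _ _]addr0.
  by apply: lpath_right (lpath_nil _ _ _ _); rewrite /edge /inM; lia.
by move: le1 le2; set A := z _ _; set B := x _ _; set C := z _ _; set D := x _ _; lra.
Qed.

(** The x-path is cut at its first point (n + 1, a + 1) of L. The part before is shifted down, the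
    part from there on is shifted left, and the upward step out of (n, a) joins them. *)
Lemma touching_shift_xz j n0 a0 i v1 v2 :
  (0 < j)%N -> n0.+1 = (r + a0)%N -> (i < r + k)%N ->
  wpath inM x k j.+1 n0 a0 v1 -> wpath inM x n0 a0 i.+1 k.+1 v2 ->
  exists n a u1 u2, [/\ n.+1 = (r + a)%N, wpath inM z k j n a u1,
    wpath inM z n a i k.+1 u2 &
    x k j.+1 + v1 + v2 <= z k j + u1 + u2].
Proof.
move=> j0 nL ik p1 p2.
have nLk : ~~ onL k j.+1 by rewrite /onL; lia.
have [/eqP//|[n [a [u1 [u2 [na q1 q2 ->]]]]]] := wpath_first_touch nLk p1.
have {}p2 := lpath_cat q2 p2.
have /andP[ni ak] := lpath_le p2.
have /andP[kn ja] := lpath_le q1.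
have [v1' [r1 le1]] := vertical_shift_xz j0 (ak : (a <= k)%N) na q1.
have [||v2' [r2 le2]] := horizontal_shift_xz _ ik _ p2.
- by rewrite /inMnL /inM /onL; lia.
- by right; lia.
exists n, a, v1', (z n a.+1 + v2'); split => //.
  by apply: lpath_up (nL_sub r2); rewrite /edge /inM; lia.
by move: le1 le2; set A := z _ _; set B := x _ _; set C := z _ _; set D := x _ _; lra.
Qed.

End ShiftInM.

(** * Path sums in I_k and in I_{k+1} *)

Section Assembly.
Variable R : realDomainType.
Variables (r s : nat).

Definition inI (k i j : nat) : bool :=
  [&& (1 <= i)%N, (1 <= j)%N, (j <= s)%N, (i < r + k)%N &
    [&& (j <= k)%N, (i < r + j)%N & (k < i + j)%N] || (k < j)%N && (k <= i)%N].

(** The polygonal chain inequalities in terms of paths, each given by its two halves at a point of L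
    or at (k, 1). The paths need not be maximal, as the weights of interest are nonnegative. *)
Definition path_sums_le (k : nat) (w : nat -> nat -> R) (l : R) : Prop :=
  forall i j n m i' j' v1 v2, inI k i j -> inI k n m ->
    onL r n m || ((n, m) == (k, 1%N)) ->
    wpath (inI k) w i j n m v1 -> wpath (inI k) w n m i' j' v2 ->
    w i j + v1 + v2 <= l.

Variable k : nat.
Hypothesis k_gt0 : (0 < k)%N.
Hypothesis k_lt_s : (k < s)%N.
Hypothesis s_le_r : (s <= r)%N.

Let k_lt_r : (k < r)%N := leq_trans k_lt_s s_le_r.
Let M := inM r k.

Section Parts.
Variables (K : nat) (w : nat -> nat -> R).
Hypothesis KE : K = k \/ K = k.+1.
Hypothesis w_ge0 : forall i j, inI K i j -> 0 <= w i j.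

(* Values of paths in the parts of I_K above and to the left of M; the value 0 stands
   for the absence of such a part. *)
Definition upper_value (i : nat) (u : R) : Prop := u = 0 \/
  exists i' j' v, [/\ inI K i k.+2, wpath (inI K) w i k.+2 i' j' v & u = w i k.+2 + v].

Definition left_value (j : nat) (u : R) : Prop := u = 0 \/
  exists i' j' v, [/\ inI K i' j', inI K k.-1 j, wpath (inI K) w i' j' k.-1 j v &
    u = w i' j' + v].

Lemma inI_inM i j : inI K i j -> (k <= i)%N -> (j <= k.+1)%N -> M i j.
Proof. by rewrite /inI /M /inM; case: KE => ->; lia. Qed.

Lemma wpath_inM_inI i j i' j' v : wpath M w i j i' j' v ->
  inI K i j -> inI K i' j' -> wpath (inI K) w i j i' j' v.
Proof.
move=> p; have /andP[ii jj] := lpath_le p; move=> m m'.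
apply: wpath_sub p => a b; move: m m'.
by rewrite /inI /M /inM; case: KE => ->; lia.
Qed.

(** The path is cut where it leaves row [k + 1] upwards. If it ends earlier, it is prolonged up to
    that row, which does not decrease its weight. *)
Lemma upper_split n m i' j' v : M n m -> inI K n m ->
  wpath (inI K) w n m i' j' v ->
  exists i u v', [/\ wpath M w n m i k.+1 v', inI K i k.+1,
    upper_value i u & v <= v' + u].
Proof.
move=> Mnm Inm p.
elim: p Mnm Inm => {n m i' j' v} [i j|i j i' j' v a p ih|i j i' j' v a p ih] Mij Iij.
- have Iib b : (j <= b <= k.+1)%N -> inI K i b.
    by move: Mij Iij; rewrite /M /inM /inI; case: KE => ->; lia.
  have jk : (j <= k.+1)%N by move: Mij; rewrite /M /inM; lia.
  exists i, 0, (\sum_(j <= b < k.+1) weight w i b true); split.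
  + apply: lpath_vline => // b Hb.
    by move: Mij; rewrite /edge /M /inM; lia.
  + by apply: Iib; rewrite jk leqnn.
  + by left.
  + rewrite addr0 big_nat; apply: sumr_ge0 => b Hb.
    by apply: w_ge0; apply: Iib; lia.
- have I' : inI K i.+1 j by case/andP: a.
  have M' : M i.+1 j by apply: inI_inM => //; move: Mij; rewrite /M /inM; lia.
  have [i2 [u [v' [q I2 U le']]]] := ih M' I'.
  exists i2, u, (w i.+1 j + v'); split => //.
    by apply: lpath_right q; rewrite /edge Mij.
  by rewrite -addrA lerD2l.
- have I' : inI K i j.+1 by case/andP: a.
  have [jk|jk] := eqVneq j k.+1.
    subst j; exists i, (w i k.+2 + v), 0; split => //.
    + exact: lpath_nil.
    + by right; exists i', j', v; split.
    + by rewrite add0r.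
  have M' : M i j.+1 by apply: inI_inM => //; move: Mij; rewrite /M /inM; lia.
  have [i2 [u [v' [q I2 U le']]]] := ih M' I'.
  exists i2, u, (w i j.+1 + v'); split => //.
    by apply: lpath_up q; rewrite /edge Mij.
  by rewrite -addrA lerD2l.
Qed.

Lemma left_cross i j n m v : (i < k)%N -> (k <= n)%N -> (m <= k.+1)%N ->
  inI K i j -> wpath (inI K) w i j n m v ->
  exists j1 v1 v2, [/\ inI K k j1, inI K k.-1 j1, wpath (inI K) w i j k.-1 j1 v1,
    wpath M w k j1 n m v2 & v = v1 + (w k j1 + v2)].
Proof.
move=> ik kn mk Iij p.
elim: p ik kn mk Iij => {i j n m v} [i j|i j n m v a p ih|i j n m v a p ih] ik kn mk Iij.
- lia.
- have I' : inI K i.+1 j by case/andP: a.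
  have [ik'|ik'] := eqVneq i.+1 k.
    exists j, 0, v; rewrite -ik' /=; split => //; first exact: lpath_nil.
      apply: wpath_sub p => b c Ibc Hb Hc; apply: inI_inM => //; lia.
    by rewrite add0r.
  have [|j1 [v1 [v2 [I1 I2 q1 q2 ->]]]] := ih _ kn mk I'; first lia.
  exists j1, (w i.+1 j + v1), v2; split => //; last by rewrite /weight; ring.
  exact: lpath_right q1.
- have I' : inI K i j.+1 by case/andP: a.
  have [j1 [v1 [v2 [I1 I2 q1 q2 ->]]]] := ih ik kn mk I'.
  exists j1, (w i j.+1 + v1), v2; split => //; last by rewrite /weight; ring.
  exact: lpath_up q1.
Qed.

(** A path that starts in M is prolonged to the left as far as column [k]. This fails only in row 1
    for [K = k.+1], as (k, 1) is not in I_{k+1}; then it is prolonged to (k + 1, 1). *)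
Lemma left_split i j n m v : inI K i j -> M n m ->
  wpath (inI K) w i j n m v ->
  (exists j1 u v', [/\ left_value j1 u, inI K k j1, wpath M w k j1 n m v' &
     w i j + v <= u + w k j1 + v']) \/
  [/\ K = k.+1, (k < n)%N & exists v', wpath M w k.+1 1 n m v' /\
     w i j + v <= w k.+1 1%N + v'].
Proof.
move=> Iij Mnm p; have /andP[ii jj] := lpath_le p.
have [kn mk] : (k <= n)%N /\ (m <= k.+1)%N by move: Mnm; rewrite /M /inM; lia.
have [ik|ki] := ltnP i k.
  have [j1 [v1 [v2 [I1 I2 q1 q2 ->]]]] := left_cross ik kn mk Iij p.
  left; exists j1, (w i j + v1), v2; split => //; last by rewrite -!addrA.
  by right; exists i, j, v1; split.
have pM : wpath M w i j n m v.
  by apply: wpath_sub p => b c Ibc Hb Hc; apply: inI_inM => //; lia.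
have row i0 : (k <= i0 <= i)%N -> inI K i0 j ->
    exists v', wpath M w i0 j n m v' /\ w i j + v <= w i0 j + v'.
  move=> Hi I0.
  have Ib b : (i0 <= b <= i)%N -> inI K b j.
    by move: Iij I0; rewrite /inI; case: KE => ->; lia.
  exists (\sum_(i0 <= b < i) weight w b j false + v); split.
    apply: lpath_cat pM; apply: lpath_hline => [|b Hb]; first lia.
    by rewrite /edge !inI_inM //; try apply: Ib; lia.
  rewrite addrA lerD2r.
  have -> : \sum_(i0 <= b < i) weight w b j false = \sum_(i0.+1 <= b < i.+1) w b j.
    by rewrite big_add1.
  rewrite -big_ltn; last lia.
  rewrite big_nat_recr /=; last lia.
  rewrite lerDr big_nat; apply: sumr_ge0 => b Hb.
  by apply: w_ge0; apply: Ib; lia.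
have [I0|nI0] := boolP (inI K k j).
  left; have [|v' [q le']] := row k _ I0; first by rewrite leqnn ki.
  by exists j, 0, v'; rewrite add0r; split => //; left.
right; have [KE' [j1 ki']] : K = k.+1 /\ j = 1%N /\ (k < i)%N.
  by move: Iij nI0; rewrite /inI; case: KE => ->; lia.
subst j; have [||v' q] := row k.+1; first lia.
  by rewrite /inI KE'; lia.
by split => //; [lia|exists v'].
Qed.

Lemma parts_le l j n m i v1 v2 u1 u2 : path_sums_le K w l ->
  left_value j u1 -> upper_value i u2 -> inI K k j -> inI K i k.+1 ->
  wpath M w k j n m v1 -> wpath M w n m i k.+1 v2 -> inI K n m ->
  onL r n m || ((n, m) == (K, 1%N)) ->
  u1 + w k j + v1 + v2 + u2 <= l.
Proof.
move=> Pl L U Ij Ii p1 p2 Inm sp.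
have q1 := wpath_inM_inI p1 Ij Inm.
have q2 := wpath_inM_inI p2 Inm Ii.
have {U} [i' [j' [v2' [q2' E2]]]] : exists i' j' v2',
    wpath (inI K) w n m i' j' v2' /\ v2 + u2 = v2'.
  case: U => [->|[i' [j' [v [I' q ->]]]]].
    by exists i, k.+1, v2; rewrite addr0.
  exists i', j', (v2 + (w i k.+2 + v)); split => //.
  by apply: lpath_cat q2 _; apply: lpath_up q; rewrite /edge Ii.
have {L} [i0 [j0 [v1' [I0 q1' E1]]]] : exists i0 j0 v1', [/\ inI K i0 j0,
    wpath (inI K) w i0 j0 n m v1' & u1 + w k j + v1 = w i0 j0 + v1'].
  case: L => [->|[i0 [j0 [v [I0 Ik q ->]]]]].
    by exists k, j, v1; rewrite add0r.
  have kE : k.-1.+1 = k by lia.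
  exists i0, j0, (v + (w k j + v1)); split => //; last by ring.
  by apply: lpath_cat q _; rewrite -[X in w X j]kE;
    apply: lpath_right; rewrite /edge ?kE ?Ik.
have -> : u1 + w k j + v1 + v2 + u2 = w i0 j0 + v1' + v2' by rewrite -E1 -E2; ring.
exact: Pl I0 Inm sp q1' q2'.
Qed.

Lemma parts_start_le l i v2 u2 : path_sums_le K w l ->
  upper_value i u2 -> inI K K 1 -> inI K i k.+1 ->
  wpath M w K 1 i k.+1 v2 -> w K 1%N + v2 + u2 <= l.
Proof.
move=> Pl U I1 Ii p2.
have q2 := wpath_inM_inI p2 I1 Ii.
have {U} [i' [j' [v2' [q2' E2]]]] : exists i' j' v2',
    wpath (inI K) w K 1 i' j' v2' /\ v2 + u2 = v2'.
  case: U => [->|[i' [j' [v [I' q ->]]]]].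
    by exists i, k.+1, v2; rewrite addr0.
  exists i', j', (v2 + (w i k.+2 + v)); split => //.
  by apply: lpath_cat q2 _; apply: lpath_up q; rewrite /edge Ii.
rewrite -addrA E2 -[w K _]addr0.
by apply: (Pl _ _ _ _ _ _ _ _ I1 I1 _ (lpath_nil _ _ _ _) q2'); rewrite eqxx orbT.
Qed.

End Parts.

(** * Comparison of the path sums of x and z *)

Variables x y z : nat -> nat -> R.
Hypothesis x_y : forall i j, M i j -> (i, j) != (k, 1%N) ->
  x i j = y i j - low r k y i j.
Hypothesis z_y : forall i j, M i j -> (i, j) != ((r + k)%N, k.+1) ->
  z i j = up r k y i j - y i j.
Hypothesis z_x : forall i j, inI k i j -> ~~ M i j ->
  z i j = if (k.+1 < j)%N then x i.+1 j else x i j.+1.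
Hypothesis x_ge0 : forall i j, inI k.+1 i j -> 0 <= x i j.
Hypothesis z_ge0 : forall i j, inI k i j -> 0 <= z i j.

(** Outside M the map only relabels coordinates, by one column above M and by one row to the left of
    M (next lemma), so paths are carried over unchanged. *)
Lemma upper_value_shift i u : upper_value k z i u <-> upper_value k.+1 x i.+1 u.
Proof.
have E a b : (k.+1 < b)%N -> (k <= a)%N -> inI k a b -> inI k.+1 a.+1 b /\ x a.+1 b = z a b.
  move=> kb ka Iab; split; first by move: Iab; rewrite /inI; lia.
  by rewrite z_x ?kb // /M /inM; lia.
have E' a b : (k.+1 < b)%N -> (k < a)%N -> inI k.+1 a b -> inI k a.-1 b /\ z a.-1 b = x a b.
  move=> kb ka Iab; have I' : inI k a.-1 b by move: Iab; rewrite /inI; lia.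
  split => //; rewrite z_x ?kb //; first by rewrite (_ : a.-1.+1 = a) //; lia.
  by rewrite /M /inM; lia.
split=> -[->|[i' [j' [v [I' p ->]]]]]; [by left| |by left|]; right.
  have ki : (k <= i)%N by move: I'; rewrite /inI; lia.
  have [//|I1 x1] := E _ _ _ ki I'.
  exists i'.+1, j', v; split => //; last by rewrite x1.
  by apply: (wpath_map (g := succn) (h := id) _ _ _ p) => // a b Iab Ha Hb;
    apply: E => //; lia.
have ki : (k < i.+1)%N by move: I'; rewrite /inI; lia.
have [//|/= I1 x1] := E' _ _ _ ki I'.
exists i'.-1, j', v; split => //; last by rewrite x1.
apply: (wpath_map (g := predn) (h := id) _ _ _ p) => // [a b Iab Ha Hb|a Ha].
  by apply: E' => //; lia.
lia.
Qed.

Lemma left_value_shift j u : (0 < j)%N ->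
  left_value k z j u <-> left_value k.+1 x j.+1 u.
Proof.
move=> j0.
have E a b : (a < k)%N -> inI k a b -> inI k.+1 a b.+1 /\ x a b.+1 = z a b.
  move=> ak Iab; split; first by move: Iab; rewrite /inI; lia.
  rewrite z_x //; last by rewrite /M /inM; lia.
  by have -> : (k.+1 < b)%N = false by move: Iab; rewrite /inI; lia.
have E' a b : (a < k)%N -> inI k.+1 a b -> inI k a b.-1 /\ z a b.-1 = x a b.
  move=> ak Iab; have I' : inI k a b.-1 by move: Iab; rewrite /inI; lia.
  split => //; rewrite z_x //; last by rewrite /M /inM; lia.
  have -> : (k.+1 < b.-1)%N = false by move: Iab; rewrite /inI; lia.
  by rewrite (_ : b.-1.+1 = b) //; move: Iab; rewrite /inI; lia.
split=> -[->|[i' [j' [v [I' Ik p ->]]]]]; [by left| |by left|]; right;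
  have /andP[ik jj] := lpath_le p.
  have [|I1 x1] := E _ _ _ I'; first lia.
  have [|I2 x2] := E _ _ _ Ik; first lia.
  exists i', j'.+1, v; split => //; last by rewrite x1.
  by apply: (wpath_map (g := id) (h := succn) _ _ _ p) => // a b Iab Ha Hb;
    apply: E => //; lia.
have [|I1 x1] := E' _ _ _ I'; first lia.
have [|I2 x2] := E' _ _ _ Ik; first lia.
exists i', j'.-1, v; split => //; last by rewrite x1.
apply: (wpath_map (g := id) (h := predn) _ _ _ p) => // [a b Iab Ha Hb|b Hb].
  by apply: E' => //; lia.
by move: I'; rewrite /inI; lia.
Qed.

(** The path is cut along the boundary of M and its outer parts are relabelled. The part in M is
    handled by [touching_shift_zx] if it meets L, and by [horizontal_shift_zx] if it starts at (k,
    1) and avoids L. *)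
Lemma path_sums_le_zx l : path_sums_le k.+1 x l -> path_sums_le k z l.
Proof.
move=> Pl i j n m i' j' v1 v2 Iij Inm sp p1 p2.
have Mnm : M n m.
  apply: (inI_inM _ Inm _ _); first by left.
    by move: sp Inm; rewrite /onL xpair_eqE /inI; lia.
  by move: sp Inm; rewrite /onL xpair_eqE /inI; lia.
have mk : (m <= k)%N by move: sp Inm; rewrite /onL xpair_eqE /inI; lia.
have [i2 [u2 [w2 [q2 I2 U le2]]]] :=
  upper_split (or_introl erefl) z_ge0 Mnm Inm p2.
have [[j1 [u1 [w1 [L Ij1 q1 le1]]]]|[]] :=
  left_split (or_introl erefl) z_ge0 Iij Mnm p1; last lia.
have /andP[kn j1m] := lpath_le q1.
have j10 : (0 < j1)%N by case/and3P: Ij1.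
have i2k : (i2 < r + k)%N by case/and5P: I2.
suff le : u1 + z k j1 + w1 + w2 + u2 <= l.
  by move: le1 le2 le; set A := z _ _; set B := z _ _; lra.
have Lx := (left_value_shift u1 j10).1 L.
have Ux := (upper_value_shift i2 u2).1 U.
have I2' : inI k.+1 i2.+1 k.+1.
  by move: I2; clear -k_gt0 k_lt_s; rewrite /inI; lia.
have touching n0 a0 v3 v4 : n0.+1 = (r + a0)%N -> wpath M z k j1 n0 a0 v3 ->
    wpath M z n0 a0 i2 k.+1 v4 -> u1 + z k j1 + v3 + v4 + u2 <= l.
  move=> na r1 r2.
  have [n' [a' [v3' [v4' [na' r1' r2' le']]]]] :=
    touching_shift_zx k_gt0 k_lt_r x_y z_y j10 na i2k r1 r2.
  have /andP[kn' ja'] := lpath_le r1'.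
  have /andP[ni' ak'] := lpath_le r2'.
  have Ij' : inI k.+1 k j1.+1.
    by move: Ij1 j1m mk; clear -k_gt0 k_lt_s k_lt_r; rewrite /inI; lia.
  have In' : inI k.+1 n' a'.
    by move: na' kn' ja' ak'; clear -k_gt0 k_lt_s k_lt_r; rewrite /inI; lia.
  have sp' : onL r n' a' || ((n', a') == (k.+1, 1%N)) by rewrite /onL na' eqxx.
  have := parts_le (or_intror erefl) Pl Lx Ux Ij' I2' r1' r2' In' sp'.
  by move: le'; set A := x _ _; set B := z _ _; lra.
have [/eqP na|nL] := boolP (onL r n m); first exact: touching na q1 q2.
(* The special point is (k, 1), below which I_k has no point, so [w1] and [u1] will vanish. *)
move: sp; rewrite (negbTE nL) /= => /eqP[nE mE]; subst n m.
have j1E : j1 = 1%N by apply/eqP; rewrite eqn_leq j1m.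
subst j1.
have nLi : ~~ onL r i2 k.+1.
  by move: i2k; clear; rewrite /onL; lia.
have [[nL' q]|[n0 [a0 [v3 [v4 [na r1 r2 E]]]]]] := wpath_last_touch k_gt0 k_lt_r nLi q2.
  have [|v' [q' le']] := horizontal_shift_zx k_gt0 k_lt_r x_y z_y _ i2k (or_introl erefl) q.
    by rewrite /inMnL nL andbT.
  have w10 := lpath_loop q1.
  have u10 : u1 = 0.
    by case: L => // -[? [? [? [_]]]]; clear; rewrite /inI; lia.
  have I1' : inI k.+1 k.+1 1.
    by clear -k_gt0 k_lt_s k_lt_r; rewrite /inI; lia.
  have := parts_start_le (or_intror erefl) Pl Ux I1' I2' q'.
  by move: le'; rewrite w10 u10; set A := x _ _; set B := z _ _; lra.
rewrite E; have /andP[_ ak] := lpath_le r2.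
have /andP[ni _] := lpath_le r2.
have /andP[kn0 a0_gt0] := lpath_le r1.
have r2' : wpath M z n0 a0 i2 k.+1 (z n0 a0.+1 + v4).
  apply: lpath_up (nL_sub r2); move: na ni ak i2k kn0 a0_gt0.
  by rewrite /edge /M /inM; clear -k_gt0 k_lt_r; lia.
have := touching n0 a0 (w1 + v3) _ na (lpath_cat q1 r1) r2'.
by set A := z _ _; set B := z _ _; lra.
Qed.

Lemma path_sums_le_xz l : path_sums_le k z l -> path_sums_le k.+1 x l.
Proof.
move=> Pl i j n m i' j' v1 v2 Iij Inm sp p1 p2.
have kn : (k < n)%N by move: sp Inm; rewrite /onL xpair_eqE /inI; lia.
have mk : (m <= k.+1)%N by move: sp Inm; rewrite /onL xpair_eqE /inI; lia.
have Mnm : M n m by apply: (inI_inM _ Inm (ltnW kn) mk); right.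
have [i2 [u2 [w2 [q2 I2 U le2]]]] :=
  upper_split (or_intror erefl) x_ge0 Mnm Inm p2.
have /andP[ni2 _] := lpath_le q2.
case: i2 => [|i2] in q2 I2 U ni2 *; first lia.
have i2k : (i2 < r + k)%N by case/and5P: I2; rewrite addnS ltnS.
have Uz := (upper_value_shift i2 u2).2 U.
have I2z : inI k i2 k.+1.
  by move: I2 i2k ni2 kn; clear -k_gt0 k_lt_s; rewrite /inI; lia.
have [[j1 [u1 [w1 [L Ij1 q1 le1]]]]|[_ _ [w1 [q1 le1]]]] :=
  left_split (or_intror erefl) x_ge0 Iij Mnm p1.
  suff le : u1 + x k j1 + w1 + w2 + u2 <= l.
    by move: le1 le2 le; set A := x _ _; set B := x _ _; lra.
  case: j1 => [|j1] in L Ij1 q1 le1 *; first by move: Ij1; clear; rewrite /inI; lia.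
  have j10 : (0 < j1)%N by move: Ij1; clear -k_gt0; rewrite /inI; lia.
  (* The path meets column [k] above row 1 and so cannot reach (k + 1, 1); its special point must
     lie on L. *)
  have na : n.+1 = (r + m)%N.
    have /andP[_ j1m] := lpath_le q1.
    by move: sp; rewrite /onL xpair_eqE; lia.
  have Lz := (left_value_shift u1 j10).2 L.
  have [n' [a' [v3' [v4' [na' r1' r2' le']]]]] :=
    touching_shift_xz k_gt0 k_lt_r x_y z_y j10 na i2k q1 q2.
  have /andP[kn' ja'] := lpath_le r1'.
  have /andP[ni' ak'] := lpath_le r2'.
  have Ij' : inI k k j1.
    by move: Ij1; clear -k_gt0 k_lt_s k_lt_r; rewrite /inI; lia.
  have In' : inI k n' a'.
    move: na' kn' ja' ni' i2k ak' j10 Ij'; clear -k_gt0 k_lt_s k_lt_r.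
    by rewrite /inI; lia.
  have sp' : onL r n' a' || ((n', a') == (k, 1%N)) by rewrite /onL na' eqxx.
  have := parts_le (or_introl erefl) Pl Lz Uz Ij' I2z r1' r2' In' sp'.
  by move: le'; set A := x _ _; set B := z _ _; lra.
(* The path starts at (k + 1, 1) and is shifted left as a whole, whether it meets L or not. *)
have Mk : inMnL r k k 1 by clear -k_gt0 k_lt_r; rewrite /inMnL /inM /onL; lia.
have [v' [q' le']] :=
  horizontal_shift_xz k_gt0 k_lt_r x_y z_y Mk i2k (or_introl erefl) (lpath_cat q1 q2).
have I1' : inI k k 1.
  by clear -k_gt0 k_lt_s k_lt_r; rewrite /inI; lia.
have := parts_start_le (or_introl erefl) Pl Uz I1' I2z (nL_sub q').
by move: le' le1 le2; set A := x _ _; set B := z _ _; set C := x _ _; lra.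
Qed.

End Assembly.

(** * Polygonal chains and lattice paths *)

Section Membership.
Variables (r s : nat).

Lemma mem_right_trapezoid i j : (pt i j \in right_trapezoid r s) =
  [&& (1 <= i)%N, (i <= r + s - 1)%N, (1 <= j)%N, (j <= s)%N & (i < r + j)%N].
Proof.
rewrite !inE /=; apply/andP/idP.
  case=> /allpairsP[[a b] /= [a_in b_in [-> ->]]].
  by move: a_in b_in; rewrite !mem_iota; lia.
move=> h; split; last lia.
by apply/allpairsP; exists (i, j); rewrite /= !mem_iota; split => //; lia.
Qed.

Lemma le_pt i j i' j' : (pt i j <= pt i' j')%O = (i <= i')%N && (j <= j')%N.
Proof. by rewrite Order.ProdOrder.leEprod. Qed.

Lemma mem_interval_in (S : {fset point}) (a b p : point) :
  (p \in interval_in S a b) = (p \in S) && (a <= p <= b)%O.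
Proof. by rewrite !inE. Qed.

Lemma mem_trapezoid i j : (pt i j \in trapezoid r s) =
  (pt i j \in right_trapezoid r s) && (s < i + j)%N.
Proof. by rewrite /trapezoid; move: (right_trapezoid r s) => S; rewrite !inE. Qed.

End Membership.

Section Intermediate.
Variables (r s k : nat).
Hypothesis k_gt0 : (0 < k)%N.
Hypothesis s_le_r : (s <= r)%N.

Lemma mem_M_interval i j : (k < s)%N ->
  (pt i j \in M_interval r s k) = inM r k i j.
Proof.
move=> ks; rewrite mem_interval_in mem_right_trapezoid !le_pt /inM; lia.
Qed.

Hypothesis k_le_s : (k <= s)%N.

Lemma mem_intermediate i j : (pt i j \in intermediate r s k) = inI r s k i j.
Proof.
rewrite in_fsetU mem_interval_in mem_trapezoid !mem_right_trapezoid !le_pt /inI.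
lia.
Qed.

Lemma mem_left_border i j : pt i j \in intermediate r s k ->
  (pt i j \in left_border r s) = onL r i j.
Proof.
rewrite mem_intermediate /inI /left_border /onL => Iij.
apply/imfsetP/eqP => [[l /=]|ijE].
  by rewrite mem_iota => ls [-> ->]; lia.
by exists j; rewrite /= ?mem_iota /pt; [lia|congr pair; lia].
Qed.

End Intermediate.

Lemma coord_val (R : realType) (S : {fset point}) (x : S -> R) (p : S) :
  coord x (val p) = x p.
Proof. by rewrite /coord valK. Qed.

Lemma coord_notin (R : realType) (S : {fset point}) (x : S -> R) (p : point) :
  p \notin S -> coord x p = 0.
Proof. by move=> pS; rewrite /coord insubN. Qed.

Section ChainsAndPaths.
Variables (R : realType) (r s k : nat).
Hypothesis k_gt0 : (0 < k)%N.
Hypothesis k_le_s : (k <= s)%N.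
Hypothesis s_le_r : (s <= r)%N.

Let I := intermediate r s k.
Let memI i j : (pt i j \in I) = inI r s k i j.
Proof. exact: mem_intermediate. Qed.

Variable x : I -> R.
Hypothesis x_ge0 : forall p, 0 <= x p.

Let w i j := coord x (pt i j).

Let w_ge0 i j : 0 <= w i j.
Proof.
have [Iij|nI] := boolP (pt i j \in I); last by rewrite /w coord_notin.
by rewrite /w -[pt i j]/(val [` Iij]%fset) coord_val.
Qed.

Let fstI (p : I) := (val p).1.
Let sndI (p : I) := (val p).2.

Let inI_val (p : I) : inI r s k (fstI p) (sndI p).
Proof. by rewrite -memI /pt -surjective_pairing; apply: valP. Qed.

Let w_val (p : I) : w (fstI p) (sndI p) = x p.
Proof. by rewrite /w /pt -surjective_pairing coord_val. Qed.

Let leI (p q : I) : (val p <= val q)%O = (fstI p <= fstI q)%N && (sndI p <= sndI q)%N.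
Proof. by rewrite Order.ProdOrder.leEprod. Qed.

Let eqI (p q : I) : fstI p = fstI q -> sndI p = sndI q -> p = q.
Proof.
by rewrite /fstI /sndI => e1 e2; apply: val_inj;
  case: (val p) (val q) e1 e2 => a b [c d] /= -> ->.
Qed.

Let compI (p q : I) : (val p >=< val q)%O =
  ((fstI p <= fstI q)%N && (sndI p <= sndI q)%N ||
   (fstI q <= fstI p)%N && (sndI q <= sndI p)%N).
Proof. by rewrite /Order.comparable !leI. Qed.

Let inI_step i j i' j' : inI r s k i j -> inI r s k i' j' ->
  (i <= i')%N -> (j <= j')%N -> (i, j) != (i', j') ->
  (i.+1 <= i')%N && inI r s k i.+1 j || (j.+1 <= j')%N && inI r s k i j.+1.
Proof. by rewrite /inI xpair_eqE; lia. Qed.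

(** The chain lies on a lattice path: one step at a time is made towards its least remaining
    element, or towards the top corner if none remains. By [inI_step] one of the two unit steps
    stays in I_k, and extra points on the way have nonnegative weight. *)
Lemma chain_sum_le_path (C : {set I}) i j i' j' : is_chain C ->
  inI r s k i j -> inI r s k i' j' -> (i <= i')%N -> (j <= j')%N ->
  (forall p, p \in C -> [&& i <= fstI p, fstI p <= i', j <= sndI p & sndI p <= j']%N) ->
  exists v, wpath (inI r s k) w i j i' j' v /\ \sum_(p in C) x p <= w i j + v.
Proof.
have [n] := ubnP ((i' - i) + (j' - j)); elim: n => // n ih in C i j *.
move=> len chC Iij Ii'j' ii jj inC.
have [[iE jE]|ne] := eqVneq (i, j) (i', j').
  subst i' j'; exists 0; split; first exact: lpath_nil.
  rewrite addr0; have [->|[p pC]] := set_0Vmem C; first by rewrite big_set0.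
  have -> : C = [set p]%SET.
    apply/setP => q; rewrite inE; apply/idP/eqP => [qC|->//].
    by apply: eqI; move: (inC _ pC) (inC _ qC);
    move: (fstI p) (sndI p) (fstI q) (sndI q); clear; lia.
  rewrite big_set1 -w_val.
  have [-> ->] // : fstI p = i /\ sndI p = j.
  by move: (inC _ pC); move: (fstI p) (sndI p); clear; lia.
pose P : I := [` (etrans (memI i j) Iij)]%fset.
pose C' := C :\ P.
have chC' : is_chain C'.
  apply/forall_inP => p /setD1P[_ pC]; apply/forall_inP => q /setD1P[_ qC].
  exact: (forall_inP (forall_inP chC _ pC)).
have [i2 [j2 [Ii2 [/andP[ii2 i2i] [/andP[jj2 j2j] [ne2 minC']]]]]] : exists i2 j2,
    inI r s k i2 j2 /\ ((i <= i2 <= i')%N /\ ((j <= j2 <= j')%N /\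
    ((i, j) != (i2, j2) /\ forall q, q \in C' -> (i2 <= fstI q)%N && (j2 <= sndI q)%N))).
  have [C0|[p0 p0C]] := set_0Vmem C'.
    by exists i', j'; rewrite ii jj !leqnn; do !split => //; move=> q; rewrite C0 inE.
  case: (arg_minnP (fun p : I => fstI p + sndI p)%N p0C) => p pC minp.
  exists (fstI p), (sndI p); split; first exact: inI_val.
  have /setD1P[pP pC0] := pC.
  have /and4P[h1 h2 h3 h4] := inC _ pC0.
  split; first by rewrite h1 h2.
  split; first by rewrite h3 h4.
  split.
    apply: contra pP => /eqP[e1 e2]; apply/eqP.
    by apply: eqI; [exact: esym e1|exact: esym e2].
  move=> q qC; have := minp _ qC.
  have := forall_inP (forall_inP chC' _ pC) _ qC; rewrite compI.
  by move: (fstI p) (sndI p) (fstI q) (sndI q); clear; lia.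
have sumC : \sum_(p in C) x p <= w i j + \sum_(p in C') x p.
  have [PC|nPC] := boolP (P \in C).
    by rewrite (big_setD1 P) //= -w_val.
  rewrite /C' (_ : C :\ P = C) ?lerDr ?w_ge0 //.
  by apply/setP => q; rewrite !inE; case: eqVneq => [->|//]; rewrite (negbTE nPC).
have /orP[/andP[ii3 I3]|/andP[jj3 I3]] := inI_step Iij Ii2 ii2 jj2 ne2.
  have [||q qC|v [pth le]] := ih C' i.+1 j _ chC' I3 Ii'j' _ jj.
  - by move: len ii3 ii2 i2i; clear; lia.
  - exact: leq_trans ii3 i2i.
  - move: (minC' _ qC) (inC q); rewrite (fintype.subsetP (subD1set C P)) // => + /(_ isT).
    by move: (fstI q) (sndI q) ii3; clear; lia.
  exists (w i.+1 j + v); split; last by apply: le_trans sumC _; rewrite lerD2l.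
  by apply: lpath_right pth; rewrite /edge Iij.
have [||q qC|v [pth le]] := ih C' i j.+1 _ chC' I3 Ii'j' ii.
- by move: len jj3 jj2 j2j; clear; lia.
- exact: leq_trans jj3 j2j.
- move: (minC' _ qC) (inC q); rewrite (fintype.subsetP (subD1set C P)) // => + /(_ isT).
  by move: (fstI q) (sndI q) jj3; clear; lia.
exists (w i j.+1 + v); split; last by apply: le_trans sumC _; rewrite lerD2l.
by apply: lpath_up pth; rewrite /edge Iij.
Qed.

Let above (C : {set I}) i j :=
  forall q, q \in C -> (i <= fstI q)%N && (j <= sndI q)%N.

Let chain_cons (C : {set I}) i j (Iij : inI r s k i j) i' j' :
  is_chain C -> above C i' j' -> (i <= i')%N -> (j <= j')%N -> (i + j < i' + j')%N ->
  let P : I := [` (etrans (memI i j) Iij)]%fset in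
  [/\ is_chain (P |: C), above (P |: C) i j &
    \sum_(p in P |: C) x p = w i j + \sum_(p in C) x p].
Proof.
move=> chC abC ii jj lt P; have aP : above (P |: C) i j.
  move=> q; rewrite !inE => /predU1P[->|/abC]; first by rewrite /P /fstI /sndI /= !leqnn.
  by lia.
split => //.
  apply/forall_inP => p pC; apply/forall_inP => q qC; rewrite compI.
  move: (pC) (qC); rewrite !inE => /predU1P[->|pC0] /predU1P[->|qC0].
  - by rewrite !leqnn.
  - by rewrite aP.
  - by rewrite (aP p) // orbT.
  - by rewrite -compI; apply: (forall_inP (forall_inP chC _ pC0)).
rewrite big_setU1 //=; first by rewrite -w_val.
by apply/negP => /abC; rewrite /fstI /sndI /=; lia.
Qed.

Let has_pt (C : {set I}) i j := exists2 p, p \in C & (fstI p, sndI p) = (i, j).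

(** [C2] is the part of the chain beyond the end of the path, so that both halves of a path can be
    collected into one chain. *)
Lemma path_chain i j i' j' v (C2 : {set I}) :
  wpath (inI r s k) w i j i' j' v -> inI r s k i j ->
  is_chain C2 -> above C2 i' j' -> has_pt C2 i' j' ->
  exists C, [/\ is_chain C, above C i j, has_pt C i j, C2 \subset C &
   \sum_(p in C) x p = w i j + v + (\sum_(p in C2) x p - w i' j')].
Proof.
move=> p Iij ch2 ab2 pt2.
elim: p Iij ch2 ab2 pt2 => {i j i' j' v}
  [i j|i j i' j' v a p ih|i j i' j' v a p ih] Iij ch2 ab2 pt2.
- by exists C2; split => //; ring.
- have I1 : inI r s k i.+1 j by case/andP: a.
  have [C [chC abC ptC sub E]] := ih I1 ch2 ab2 pt2.
  have [ch ab sum] := chain_cons Iij chC abC (leqnSn i) (leqnn j) (ltnSn _).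
  eexists; split; [exact: ch|exact: ab| | |].
  + by eexists; [exact: setU11|].
  + exact: (fintype.subset_trans sub (finset.subsetUr _ _)).
  + by rewrite sum E /weight; ring.
- have I1 : inI r s k i j.+1 by case/andP: a.
  have [C [chC abC ptC sub E]] := ih I1 ch2 ab2 pt2.
  have lt : (i + j < i + j.+1)%N by rewrite addnS.
  have [ch ab sum] := chain_cons Iij chC abC (leqnn i) (leqnSn j) lt.
  eexists; split; [exact: ch|exact: ab| | |].
  + by eexists; [exact: setU11|].
  + exact: (fintype.subset_trans sub (finset.subsetUr _ _)).
  + by rewrite sum E /weight; ring.
Qed.

Definition special (p : I) : bool := (val p \in left_border r s) || (val p == pt k 1).

Let specialE p : special p = onL r (fstI p) (sndI p) || ((fstI p, sndI p) == (k, 1%N)).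
Proof.
rewrite -(mem_left_border k_gt0 s_le_r k_le_s); last by rewrite memI inI_val.
by rewrite /special /pt -surjective_pairing.
Qed.

Lemma polygonalP (C : {set I}) :
  polygonal C <-> maximal_chain C /\ exists2 p, p \in C & special p.
Proof.
rewrite /polygonal; split.
  case/andP=> mC /orP[/existsP[p /andP[pC h]]|/existsP[p /andP[pC h]]];
  by split => //; exists p; rewrite // /special h ?orbT.
case=> -> [p pC /orP[h|h]] /=; apply/orP; [left|right];
by apply/existsP; exists p; rewrite pC.
Qed.

(** The chain extends to a maximal one, which is polygonal because it still contains the special
    point. *)
Lemma special_chain_le (l : R) (C : {set I}) :
  (forall C : {set I}, polygonal C -> \sum_(p in C) x p <= l) ->
  is_chain C -> (exists2 p, p \in C & special p) -> \sum_(p in C) x p <= l.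
Proof.
move=> Pl chC [p pC sp]; have [B mB sub] := maxset_exists chC.
apply: le_trans (Pl B _); last first.
  by apply/polygonalP; split => //; exists p => //; apply: (fintype.subsetP sub).
rewrite [leRHS](big_setID C) /= (finset.setIidPr sub) lerDl.
exact: sumr_ge0.
Qed.

Lemma polygonal_path_sums (l : R) :
  (forall C : {set I}, polygonal C -> \sum_(p in C) x p <= l) <->
  path_sums_le r s k w l.
Proof.
split=> [Pl i j n m i' j' v1 v2 Iij Inm sp p1 p2|Pl C].
  have Ii'j' := wpath_end Inm p2.
  pose Q : I := [` (etrans (memI i' j') Ii'j')]%fset.
  have chQ : is_chain [set Q]%SET.
    by apply/forall_inP => q /set1P->; apply/forall_inP => q' /set1P->; rewrite comparablexx.
  have abQ : above [set Q]%SET i' j' by move=> q /set1P->; rewrite !leqnn.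
  have ptQ : has_pt [set Q]%SET i' j' by exists Q; rewrite // set11.
  have [C1 [ch1 ab1 pt1 _ E1]] := path_chain p2 Inm chQ abQ ptQ.
  have [C [chC _ _ sub E]] := path_chain p1 Iij ch1 ab1 pt1.
  have : \sum_(p in C) x p <= l.
    apply: special_chain_le => //; case: pt1 => q qC1 [e1 e2].
    by exists q; [exact: (fintype.subsetP sub)|rewrite specialE e1 e2].
  rewrite E E1 big_set1 -[x Q]w_val.
  by rewrite (_ : w (fstI Q) (sndI Q) = w i' j') //; lra.
move=> /polygonalP[mC [p pC sp]].
have chC : is_chain C by case/maxsetP: mC.
case: (arg_minnP (fun p : I => fstI p + sndI p)%N pC) => a aC mina.
case: (arg_maxnP (fun p : I => fstI p + sndI p)%N pC) => b bC maxb.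
have ab q : q \in C ->
  [&& fstI a <= fstI q, fstI q <= fstI b, sndI a <= sndI q & sndI q <= sndI b]%N.
  move=> qC; have := mina _ qC; have := maxb _ qC.
  have := forall_inP (forall_inP chC _ aC) _ qC.
  have := forall_inP (forall_inP chC _ bC) _ qC.
  rewrite !compI; move: (fstI a) (sndI a) (fstI b) (sndI b) (fstI q) (sndI q).
  by clear; lia.
(* The chain is split at its special point [p], which belongs to both halves and is counted
   twice. *)
pose lo := [set q in C | (val q <= val p)%O]%SET.
pose hi := [set q in C | (val p <= val q)%O]%SET.
have sub_chain (A : {set I}) : A \subset C -> is_chain A.
  move=> /fintype.subsetP sA; apply/forall_inP => q qA; apply/forall_inP => q' qA'.
  by apply: (forall_inP (forall_inP chC _ (sA _ qA))); apply: sA.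
have /and4P[ap1 pb1 ap2 pb2] := ab _ pC.
have [||v1 [p1 le1]] := @chain_sum_le_path lo (fstI a) (sndI a) (fstI p) (sndI p) _
    (inI_val a) (inI_val p) ap1 ap2.
- by apply: sub_chain; apply/fintype.subsetP => q; rewrite inE => /andP[].
- by move=> q; rewrite inE leI => /andP[/ab/and4P[-> _ -> _] ->].
have [||v2 [p2 le2]] := @chain_sum_le_path hi (fstI p) (sndI p) (fstI b) (sndI b) _
    (inI_val p) (inI_val b) pb1 pb2.
- by apply: sub_chain; apply/fintype.subsetP => q; rewrite inE => /andP[].
- by move=> q; rewrite inE leI => /andP[/ab/and4P[_ -> _ ->]]; rewrite andbT.
have sum : \sum_(q in C) x q + x p <= \sum_(q in lo) x q + \sum_(q in hi) x q.
  rewrite (big_setID lo) /= (finset.setIidPr _); last first.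
    by apply/fintype.subsetP => q; rewrite inE => /andP[].
  rewrite [X in _ <= _ + X](big_setD1 p) /=; last by rewrite inE pC lexx.
  rewrite -addrA lerD2l addrC lerD2l (_ : C :\: lo = hi :\ p) //.
  apply/setP => q; rewrite !inE; case qC: (q \in C); rewrite ?andbF //=.
  have := forall_inP (forall_inP chC _ qC) _ pC.
  rewrite compI !leI; case: (eqVneq q p) => [->|ne /=]; first by rewrite !leqnn.
  case: (boolP (_ && _)) => //= /andP[qp1 qp2] _; apply/esym/negbTE.
  apply: contra ne => /andP[pq1 pq2]; apply/eqP.
  by apply: eqI; apply/eqP; rewrite eqn_leq ?qp1 ?qp2.
have sp' : onL r (fstI p) (sndI p) || ((fstI p, sndI p) == (k, 1%N)) by rewrite -specialE.
have := Pl _ _ _ _ _ _ _ _ (inI_val a) (inI_val p) sp' p1 p2.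
by move: le1 le2 sum; rewrite !w_val; lra.
Qed.

(** The witness is the point of L in the row of [p] if that row is at most [k], and (k, 1)
    otherwise. It puts [p] on a polygonal chain and thereby bounds the coordinate at [p]. *)
Lemma special_above_or_below (p : I) : exists2 t, special t & (val p >=< val t)%O.
Proof.
have Ip := inI_val p; have [pk|kp] := leqP (sndI p) k.
  have It : pt (r + sndI p).-1 (sndI p) \in I.
    by rewrite memI; move: Ip pk; rewrite /inI; move: (fstI p) (sndI p); lia.
  exists [` It]%fset.
    by rewrite specialE /onL; move: Ip; rewrite /inI /fstI /sndI /=; lia.
  by rewrite compI; move: Ip pk; rewrite /inI /fstI /sndI /=; lia.
have It : pt k 1 \in I by rewrite memI /inI; lia.
exists [` It]%fset; first by rewrite specialE eqxx orbT.
by rewrite compI; move: Ip kp; rewrite /inI /fstI /sndI /=; lia.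
Qed.

Lemma le_special_sum (l : R) (p : I) :
  (forall C : {set I}, polygonal C -> \sum_(p in C) x p <= l) -> x p <= l.
Proof.
move=> Pl; have [t st pt] := special_above_or_below p.
apply: le_trans (special_chain_le (C := [set p; t]%SET) Pl _ _).
- by rewrite (bigD1 p) ?inE ?eqxx //= lerDl sumr_ge0.
- apply/forall_inP => q /set2P[]->; apply/forall_inP => q' /set2P[]->;
  by rewrite ?comparablexx // comparable_sym.
- by exists t; rewrite ?inE ?eqxx ?orbT.
Qed.

End ChainsAndPaths.

Lemma dilate_polygonal (R : realType) (r s k l : nat) : (0 < k)%N -> (k <= s)%N ->
  (s <= r)%N ->
  dilate l (@polygonal_chain_polytope R r s k) =
  [set x | (forall p, 0 <= x p) /\ forall C, polygonal C -> \sum_(p in C) x p <= l%:R].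
Proof.
move=> k0 ks sr; apply/seteqP; split=> [_ [u [u0 uC] <-]|x [x0 xC]].
  split=> [p|C pC]; first by rewrite mulr_ge0.
  by rewrite -mulr_sumr -[leRHS]mulr1 ler_wpM2l // uC.
have [l0|l0] := posnP l; last first.
  exists (l%:R^-1 *: x); last by rewrite scalerA divff ?scale1r // pnatr_eq0 -lt0n.
  split=> [p|C pC]; first by rewrite mulr_ge0 ?invr_ge0.
  by rewrite -mulr_sumr mulrC ler_pdivrMr ?ltr0n // mul1r xC.
(* The dilate by 0 is the origin alone; with right-hand side 0 the inequalities leave no other
   point, since they bound every coordinate. *)
have x0E : x = 0.
  apply/funext => p; apply/eqP; rewrite eq_le x0 andbT.
  by have := le_special_sum k0 ks sr x0 p xC; rewrite l0.
exists 0; last by rewrite x0E scaler0.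
by split=> // C _; rewrite big1 // ler01.
Qed.

(** * The recursion behind zeta *)

Lemma sup_eq_max (R : realType) (S : set R) (v : R) : S v -> ubound S v -> sup S = v.
Proof.
move=> Sv ub; apply/eqP; rewrite eq_le; apply/andP; split.
  by apply: ge_sup => //; exists v.
by apply: ub_le_sup => //; exists v.
Qed.

Lemma inf_eq_min (R : realType) (S : set R) (v : R) : S v -> lbound S v -> inf S = v.
Proof.
move=> Sv lb; apply/eqP; rewrite eq_le; apply/andP; split.
  by apply: ge_inf => //; exists v.
by apply: lb_le_inf => //; exists v.
Qed.

Section ZetaRecursion.
Variables (R : realType) (r s k : nat).
Hypothesis k_gt0 : (0 < k)%N.
Hypothesis k_lt_s : (k < s)%N.
Hypothesis s_le_r : (s <= r)%N.

Let k_lt_r : (k < r)%N := leq_trans k_lt_s s_le_r.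
Let memM i j : (pt i j \in M_interval r s k) = inM r k i j.
Proof. exact: mem_M_interval. Qed.

(** Below any (a, b) > (i, j) in M there is a unit step out of (i, j) inside M: upwards if j < b,
    which never crosses L, and to the right otherwise. *)
Lemma covered_by_M i j q : covered_by (M_interval r s k) (pt i j) q <->
  [/\ inM r k i j, inM r k q.1 q.2 & q = pt i.+1 j \/ q = pt i j.+1].
Proof.
case: q => a b; rewrite /covered_by -[(a, b)]/(pt a b) !memM /=.
have ltE i1 j1 i2 j2 : (pt i1 j1 < pt i2 j2)%O =
  [&& (i1 <= i2)%N, (j1 <= j2)%N & (i1 != i2) || (j1 != j2)].
  by rewrite lt_neqAle le_pt /pt xpair_eqE; lia.
split=> [/and4P[Mij Mab]|[Mij Mab ab]].
  rewrite ltE => lt /forallP nz; split => //.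
  have nb c d : inM r k c d -> ~~ ((pt i j < pt c d)%O && (pt c d < pt a b)%O).
    by rewrite -memM => Mcd; apply: (nz [` Mcd]%fset).
  have [jb|bj] := ltnP j b.
    right; have := nb i j.+1; rewrite !ltE /pt; move: Mij Mab lt; rewrite /inM => Mij Mab lt h.
    have {}h := h ltac:(clear -Mij Mab lt jb; lia).
    by congr pair; clear -h lt jb; lia.
  left; have := nb i.+1 j; rewrite !ltE /pt; move: Mij Mab lt; rewrite /inM => Mij Mab lt h.
  have {}h := h ltac:(clear -Mij Mab lt bj; lia).
  by congr pair; clear -h lt bj; lia.
rewrite Mij Mab ltE /=; apply/andP; split.
  by case: ab => -[-> ->]; lia.
apply/forallP => z; rewrite [val z]surjective_pairing -[(_, _)]/(pt _ _) !ltE.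
by case: ab => -[-> ->]; lia.
Qed.

(** This lemma and the next three show that [low] and [up] are the extrema over covers, which avoids
    later case distinctions along the boundary of M. *)
Lemma low_ub (y : nat -> nat -> R) i j a b :
  covered_by (M_interval r s k) (pt a b) (pt i j) -> y a b <= low r k y i j.
Proof.
move=> /covered_by_M[Mab /= Mij E]; rewrite /low /onL.
case: E => -[iE jE]; subst i j.
  have -> : (a.+1 == k) = false by move: Mab; rewrite /inM; lia.
  by case: ifP => _ //; rewrite le_max lexx.
have [//|ak] := eqVneq a k.
have -> : (b.+1 == 1%N) || (a.+1 == r + b.+1)%N = false by move: Mab; rewrite /inM; lia.
by rewrite le_max lexx orbT.
Qed.

Lemma low_attained (y : nat -> nat -> R) i j : inM r k i j -> (i, j) != (k, 1%N) ->
  exists a b, covered_by (M_interval r s k) (pt a b) (pt i j) /\ y a b = low r k y i j.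
Proof.
move=> Mij ne.
have down : (i == k) || (j != 1%N) && ~~ onL r i j ->
    covered_by (M_interval r s k) (pt i j.-1) (pt i j).
  move=> h; have j1 : (1 < j)%N by move: h ne Mij; rewrite /inM xpair_eqE; lia.
  apply/covered_by_M; split => //.
    by move: h Mij; rewrite /inM /onL; lia.
  by right; rewrite prednK // ltnW.
have left : i != k -> covered_by (M_interval r s k) (pt i.-1 j) (pt i j).
  move=> ik; apply/covered_by_M; split => //.
    by move: Mij; rewrite /inM; lia.
  by left; rewrite prednK //; move: Mij; rewrite /inM; lia.
rewrite /low; have [ik|ik] := eqVneq i k.
  by exists i, j.-1; split => //; apply: down; rewrite ik eqxx.
case: ifP => [h|/norP h].
  by exists i.-1, j; split => //; apply: left.
rewrite maxEle; case: ifP => _; [exists i, j.-1|exists i.-1, j]; split => //.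
  by apply: down; case: h => -> ->; rewrite orbT.
exact: left.
Qed.

Lemma up_lb (y : nat -> nat -> R) i j a b :
  covered_by (M_interval r s k) (pt i j) (pt a b) -> up r k y i j <= y a b.
Proof.
move=> /covered_by_M[Mij /= Mab E]; rewrite /up /onL.
case: E => -[aE bE]; subst a b.
  have -> : (i.+1 == r + j)%N = false by move: Mab; rewrite /inM; lia.
  by case: ifP => _ //; rewrite ge_min lexx.
have -> : (j == k.+1) = false by move: Mab; rewrite /inM; lia.
by case: ifP => _ //; rewrite ge_min lexx orbT.
Qed.

Lemma up_attained (y : nat -> nat -> R) i j : inM r k i j ->
  (i, j) != ((r + k)%N, k.+1) ->
  exists a b, covered_by (M_interval r s k) (pt i j) (pt a b) /\ y a b = up r k y i j.
Proof.
move=> Mij ne.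
have right : (j == k.+1) || ~~ onL r i j ->
    covered_by (M_interval r s k) (pt i j) (pt i.+1 j).
  move=> h; apply/covered_by_M; split => //; last by left.
  by move: h ne Mij; rewrite /inM /onL xpair_eqE /=; lia.
have above : j != k.+1 -> covered_by (M_interval r s k) (pt i j) (pt i j.+1).
  move=> h; apply/covered_by_M; split => //; last by right.
  by move: h Mij; rewrite /inM /=; lia.
rewrite /up; have [jk|jk] := eqVneq j k.+1.
  by exists i.+1, j; split => //; apply: right; rewrite jk eqxx.
case: ifP => [h|/negbT h]; first by exists i, j.+1; split => //; apply: above.
rewrite minEle; case: ifP => _; [exists i.+1, j|exists i, j.+1]; split => //.
  by apply: right; rewrite h orbT.
exact: above.
Qed.

Section Values.
Variable x : intermediate r s k.+1 -> R.

Definition maxval (i j : nat) : R := chain_max x (pt i j).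

Let chain_to (p : point) : set (seq point) :=
  [set c | path (covered_by (M_interval r s k)) (pt k 1) c /\ last (pt k 1) c = p].

(** The recursion needs a chain that attains the supremum in [chain_max], so attainment is carried
    through the induction. *)
Let is_max (p : point) (v : R) :=
  (exists2 c, chain_to p c & \sum_(q <- pt k 1 :: c) xbar x q = v) /\
  forall c, chain_to p c -> \sum_(q <- pt k 1 :: c) xbar x q <= v.

Let is_max_eq p v : is_max p v -> chain_max x p = v.
Proof.
case=> [[c pc cv] ub]; apply: sup_eq_max; first by exists c.
by move=> _ [c' pc' <-]; apply: ub.
Qed.

(** Each cover raises the coordinate sum by one; hence only the empty chain leads from (k, 1) to
    itself. *)
Let path_rank c p : path (covered_by (M_interval r s k)) p c ->
  ((last p c).1 + (last p c).2 = p.1 + p.2 + size c)%N.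
Proof.
elim: c p => [|q c ih] [i j] /=; first by rewrite addn0.
case/andP=> /covered_by_M[_ _ E] /ih ->.
by case: E => -> /=; lia.
Qed.

Let is_max_bot : is_max (pt k 1) 0.
Proof.
split=> [|c [pc lc]]; first by exists [::]; rewrite // big_seq1 /xbar eqxx.
have := path_rank pc; rewrite lc; case: c {pc lc} => [|q c] /=; last lia.
by rewrite big_seq1 /xbar eqxx.
Qed.

Let is_max_step i j : inM r k i j -> (i, j) != (k, 1%N) ->
  (forall a b, covered_by (M_interval r s k) (pt a b) (pt i j) ->
     is_max (pt a b) (maxval a b)) ->
  is_max (pt i j) (xbar x (pt i j) + low r k maxval i j).
Proof.
move=> Mij ne IH; split.
  have [a [b [cov <-]]] := low_attained maxval Mij ne.
  have [[c [pc lc] cv] _] := IH _ _ cov.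
  exists (rcons c (pt i j)); first by rewrite /chain_to /= rcons_path pc lc last_rcons.
  by rewrite -rcons_cons -cats1 big_cat big_seq1 /= cv addrC.
move=> c; case/lastP: c => [|c p]; first by case=> _ /= [iE jE]; rewrite -iE -jE eqxx in ne.
case; rewrite rcons_path last_rcons => /andP[pc cov] pE; subst p.
rewrite -rcons_cons -cats1 big_cat big_seq1 /= addrC lerD2l.
move: cov; case E : (last _ c) => [a b] cov.
apply: le_trans (low_ub maxval cov).
by have [_ ub] := IH _ _ cov; apply: ub.
Qed.

Let is_max_maxval i j : inM r k i j -> is_max (pt i j) (maxval i j).
Proof.
have [n] := ubnP (i + j); elim: n i j => // n ih i j lt Mij.
have [[-> ->]|ne] := eqVneq (i, j) (k, 1%N).
  by rewrite /maxval (is_max_eq is_max_bot); apply: is_max_bot.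
have h : is_max (pt i j) (xbar x (pt i j) + low r k maxval i j).
  apply: is_max_step => // a b /covered_by_M[Mab _ E]; apply: ih => //.
  by case: E => -[? ?]; subst; clear -lt; lia.
by rewrite [maxval i j](is_max_eq h).
Qed.

Lemma maxval_bot : maxval k 1 = 0.
Proof. exact: is_max_eq is_max_bot. Qed.

Lemma maxval_rec i j : inM r k i j -> (i, j) != (k, 1%N) ->
  maxval i j = coord x (pt i j) + low r k maxval i j.
Proof.
move=> Mij ne; have -> : coord x (pt i j) = xbar x (pt i j).
  by rewrite /xbar /pt (negbTE ne).
apply: is_max_eq; apply: is_max_step => // a b /covered_by_M[Mab _ _].
exact: is_max_maxval.
Qed.

Lemma zeta_inM (p : intermediate r s k) : inM r k (val p).1 (val p).2 ->
  zeta x p = up r k maxval (val p).1 (val p).2 - maxval (val p).1 (val p).2.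
Proof.
move=> Mp; have := valP p; rewrite /zeta.
rewrite [val p]surjective_pairing -[(_, _)]/(pt _ _).
move: Mp; move: (val p).1 (val p).2 => i j Mij; rewrite memM Mij => Iij /=.
(* The top of M, which has no upper cover in M, does not belong to I_k. *)
congr (_ - _); have ne : (i, j) != ((r + k)%N, k.+1).
  move: Iij; rewrite mem_intermediate //; last exact: ltnW.
  by rewrite /inI xpair_eqE; lia.
apply: inf_eq_min.
  have [a [b [cov <-]]] := up_attained maxval Mij ne.
  by exists (pt a b).
by move=> _ [[a b] cov <-]; apply: up_lb.
Qed.

Lemma zeta_notinM (p : intermediate r s k) : ~~ inM r k (val p).1 (val p).2 ->
  zeta x p = if (k.+1 < (val p).2)%N then coord x (pt (val p).1.+1 (val p).2)
             else coord x (pt (val p).1 (val p).2.+1).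
Proof.
rewrite /zeta [val p]surjective_pairing -[((val p).1, _)]/(pt _ _) -memM => /negbTE -> /=.
by rewrite !addn1.
Qed.

End Values.

(* Continuity, piecewise linearity and integrality are all instances of this. *)
Lemma zeta_closed_class (Pr : ((intermediate r s k.+1 -> R) -> R) -> Prop) :
  (forall p, Pr (fun x => x p)) -> Pr (fun=> 0) ->
  (forall F G, Pr F -> Pr G -> Pr (fun x => F x + G x)) ->
  (forall F G, Pr F -> Pr G -> Pr (fun x => F x - G x)) ->
  (forall F G, Pr F -> Pr G -> Pr (fun x => Num.max (F x) (G x))) ->
  (forall F G, Pr F -> Pr G -> Pr (fun x => Num.min (F x) (G x))) ->
  forall p, Pr (fun x => zeta x p).
Proof.
move=> Pp P0 PD PB Pmax Pmin p.
have Pcoord q : Pr (fun x => coord x q).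
  by rewrite /coord; case: insubP.
have Pext F G : (forall x, F x = G x) -> Pr G -> Pr F by move=> /funext ->.
have Py i j : inM r k i j -> Pr (fun x => maxval x i j).
  have [n] := ubnP (i + j); elim: n i j => // n ih i j lt Mij.
  have [[-> ->]|ne] := eqVneq (i, j) (k, 1%N).
    by apply: Pext P0 => x; apply: maxval_bot.
  apply: Pext (fun x => maxval_rec x Mij ne) _.
  apply: PD => //; rewrite /low.
  have left : i != k -> Pr (fun x => maxval x i.-1 j).
    by move=> ik; apply: ih; move: Mij lt ik; rewrite /inM; clear -k_gt0; lia.
  have down : (j != 1%N) && ((i == k) || ~~ onL r i j) -> Pr (fun x => maxval x i j.-1).
    by move=> h; apply: ih; move: Mij lt h; rewrite /inM /onL; clear -k_gt0 k_lt_r; lia.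
  have [ik|ik] := eqVneq i k.
    by apply: down; move: ne; rewrite xpair_eqE ik eqxx /= => ->.
  case: (boolP ((j == 1%N) || onL r i j)) => [h|/norP[h1 h2]]; first exact: left.
  by apply: Pmax; [exact: left|apply: down; rewrite h1 h2 orbT].
have [Mp|nMp] := boolP (inM r k (val p).1 (val p).2); last first.
  apply: Pext (fun x => zeta_notinM x nMp) _.
  by case: (ltnP k.+1 (val p).2) => _; apply: Pcoord.
apply: Pext (fun x => zeta_inM x Mp) _; apply: PB; last exact: Py.
have := valP p; rewrite [val p]surjective_pairing -[(_, _)]/(pt _ _).
move: Mp; move: (val p).1 (val p).2 => i j Mij.
rewrite mem_intermediate //; last exact: ltnW.
rewrite /inI /up => Iij.
have right : (j == k.+1) || ~~ onL r i j -> Pr (fun x => maxval x i.+1 j).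
  by move=> h; apply: Py; move: Mij Iij h; rewrite /inM /onL; clear -k_gt0 k_lt_r; lia.
have above : j != k.+1 -> Pr (fun x => maxval x i j.+1).
  by move=> h; apply: Py; move: Mij h; rewrite /inM; clear -k_gt0; lia.
have [jk|jk] := eqVneq j k.+1; first by apply: right; rewrite jk eqxx.
case: (boolP (onL r i j)) => [_|h]; first exact: above.
by apply: Pmin; [apply: right; rewrite h orbT|exact: above].
Qed.

End ZetaRecursion.

(** * Bijectivity of zeta *)

Section ZetaBijection.
Variables (R : realType) (r s k : nat).
Hypothesis k_gt0 : (0 < k)%N.
Hypothesis k_lt_s : (k < s)%N.
Hypothesis s_le_r : (s <= r)%N.

Let k_lt_r : (k < r)%N := leq_trans k_lt_s s_le_r.
Let mem_Ik i j : (pt i j \in intermediate r s k) = inI r s k i j.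
Proof. by apply: mem_intermediate => //; apply: ltnW. Qed.
Let mem_IkS i j : (pt i j \in intermediate r s k.+1) = inI r s k.+1 i j.
Proof. exact: mem_intermediate. Qed.

Let cov i j a b := covered_by (M_interval r s k) (pt i j) (pt a b).

Let covP i j a b : cov i j a b -> [/\ inM r k i j, inM r k a b &
  (a, b) = (i.+1, j) \/ (a, b) = (i, j.+1)].
Proof. by move=> /(covered_by_M k_gt0 k_lt_s s_le_r)[]. Qed.

Let inM_Ik i j : inM r k i j -> (i, j) != ((r + k)%N, k.+1) -> inI r s k i j.
Proof. by rewrite /inM /inI xpair_eqE; clear -k_gt0 k_lt_s k_lt_r; lia. Qed.

Let inM_IkS i j : inM r k i j -> (i, j) != (k, 1%N) -> inI r s k.+1 i j.
Proof. by rewrite /inM /inI xpair_eqE; clear -k_gt0 k_lt_s k_lt_r; lia. Qed.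

Let cov_neq_top i j a b : cov i j a b -> (i, j) != ((r + k)%N, k.+1).
Proof.
move=> /covP[Mij Mab E]; apply/eqP => -[iE jE]; move: Mab.
by case: E => -[-> ->]; rewrite iE jE /inM; clear; lia.
Qed.

Let cov_neq_bot i j a b : cov i j a b -> (a, b) != (k, 1%N).
Proof.
move=> /covP[Mij Mab E]; apply/eqP => -[aE bE]; move: Mij.
by case: E => -[E1 E2]; move: aE bE; rewrite E1 E2 /inM; clear; lia.
Qed.

Let low_eq (y y' : nat -> nat -> R) i j : inM r k i j -> (i, j) != (k, 1%N) ->
  (forall a b, cov a b i j -> y a b = y' a b) -> low r k y i j = low r k y' i j.
Proof.
move=> Mij ne E; apply/eqP; rewrite eq_le; apply/andP; split.
  have [a [b [c <-]]] := low_attained k_gt0 k_lt_s s_le_r y Mij ne.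
  by rewrite (E _ _ c); apply: low_ub c.
have [a [b [c <-]]] := low_attained k_gt0 k_lt_s s_le_r y' Mij ne.
by rewrite -(E _ _ c); apply: low_ub c.
Qed.

(** A constant is allowed because z determines y only up to an additive constant. *)
Let up_shift (y y' : nat -> nat -> R) (d : R) i j : inM r k i j ->
  (i, j) != ((r + k)%N, k.+1) ->
  (forall a b, cov i j a b -> y a b = y' a b + d) -> up r k y i j = up r k y' i j + d.
Proof.
move=> Mij ne E; apply/eqP; rewrite eq_le; apply/andP; split.
  have [a [b [c <-]]] := up_attained k_gt0 k_lt_s s_le_r y' Mij ne.
  by rewrite -(E _ _ c); apply: up_lb c.
have [a [b [c <-]]] := up_attained k_gt0 k_lt_s s_le_r y Mij ne.
by rewrite (E _ _ c) lerD2r; apply: up_lb c.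
Qed.

Let downward (P : nat -> nat -> Prop) :
  P (r + k)%N k.+1 ->
  (forall i j, inM r k i j -> (i, j) != ((r + k)%N, k.+1) ->
     (forall a b, cov i j a b -> P a b) -> P i j) ->
  forall i j, inM r k i j -> P i j.
Proof.
move=> Ptop step i j.
have [n] := ubnP ((r + k + k.+1) - (i + j)).
elim: n i j => // n ih i j lt Mij.
have [[-> ->]//|ne] := eqVneq (i, j) ((r + k)%N, k.+1).
apply: step => // a b /covP[_ Mab E]; apply: ih => //.
by move: Mij Mab lt ne; case: E => -[-> ->]; rewrite /inM xpair_eqE; clear; lia.
Qed.

Section OnePoint.
Variable x : intermediate r s k.+1 -> R.
Lemma coord_inside_M i j : inM r k i j -> (i, j) != (k, 1%N) ->
  coord x (pt i j) = maxval x i j - low r k (maxval x) i j.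
Proof. by move=> Mij ne; rewrite (maxval_rec k_gt0 k_lt_s s_le_r x Mij ne) addrK. Qed.

Let y := maxval x.
Let z i j := coord (zeta x) (pt i j).

Let z_y i j : inM r k i j -> (i, j) != ((r + k)%N, k.+1) ->
  z i j = up r k y i j - y i j.
Proof.
move=> Mij ne; have Iij : pt i j \in intermediate r s k by rewrite mem_Ik inM_Ik.
by rewrite /z -[pt i j]/(val [` Iij]%fset) coord_val zeta_inM.
Qed.

Let z_x i j : inI r s k i j -> ~~ inM r k i j ->
  z i j = if (k.+1 < j)%N then coord x (pt i.+1 j) else coord x (pt i j.+1).
Proof.
rewrite -mem_Ik => Iij nM.
by rewrite /z -[pt i j]/(val [` Iij]%fset) coord_val zeta_notinM.
Qed.

Lemma coord_ge0 (S : {fset point}) (u : S -> R) :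
  (forall p, 0 <= u p) -> forall p, 0 <= coord u p.
Proof. by move=> u0 p; rewrite /coord; case: insubP. Qed.

(** If q covers p in M, then y_q is x_q plus a maximum over lower covers that includes y_p, so y_q
    >= y_p. *)
Lemma zeta_ge0 : (forall p, 0 <= x p) -> forall p, 0 <= zeta x p.
Proof.
move=> x0 p; have [Mp|nMp] := boolP (inM r k (val p).1 (val p).2); last first.
  by rewrite zeta_notinM //; case: ifP => _; apply: coord_ge0.
rewrite zeta_inM //; have := valP p; rewrite [val p]surjective_pairing.
rewrite -[(_, _)]/(pt _ _) mem_Ik.
move: Mp; move: (val p).1 (val p).2 => i j Mij Iij.
have ne : (i, j) != ((r + k)%N, k.+1) by move: Iij; rewrite /inI xpair_eqE; clear; lia.
have [a [b [c <-]]] := up_attained k_gt0 k_lt_s s_le_r y Mij ne.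
have [_ Mab _] := covP c.
rewrite subr_ge0 [leRHS](maxval_rec k_gt0 k_lt_s s_le_r x Mab (cov_neq_bot c)).
by rewrite -[leLHS]add0r; apply: lerD; [exact: coord_ge0|exact: low_ub c].
Qed.

Lemma coord_outside_M i j : inI r s k.+1 i j -> ~~ inM r k i j ->
  coord x (pt i j) =
  if (k.+1 < j)%N then coord (zeta x) (pt i.-1 j) else coord (zeta x) (pt i j.-1).
Proof.
move=> Iij nM; have [i0 j0] : (0 < i)%N /\ (0 < j)%N.
  by move: Iij; rewrite /inI; clear; lia.
have [jk|kj] := ltnP k.+1 j.
  rewrite -[RHS]/(z i.-1 j) z_x ?jk ?prednK //.
    by move: Iij jk; rewrite /inI; clear -k_gt0; lia.
  by move: jk; rewrite /inM; clear; lia.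
rewrite -[RHS]/(z i j.-1) z_x; last 2 first.
- by move: Iij kj nM; rewrite /inI /inM; clear -k_gt0 k_lt_r; lia.
- by move: Iij kj nM; rewrite /inI /inM; clear -k_gt0 k_lt_r; lia.
by have -> : (k.+1 < j.-1)%N = false; [move: kj; clear; lia|rewrite prednK].
Qed.

Let x_inside i j : inI r s k.+1 i j -> inM r k i j ->
  exists a b, cov a b i j /\ coord x (pt i j) = y i j - y a b.
Proof.
move=> Iij Mij.
have ne : (i, j) != (k, 1%N) by move: Iij; rewrite /inI xpair_eqE; clear; lia.
have [a [b [c E]]] := low_attained k_gt0 k_lt_s s_le_r y Mij ne.
by exists a, b; rewrite coord_inside_M // -/y E.
Qed.

Let coord_ind (P : R -> Prop) :
  (forall i j, inI r s k.+1 i j -> P (coord x (pt i j))) -> forall p, P (x p).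
Proof.
move=> h p; rewrite -coord_val [val p]surjective_pairing; apply: h.
by rewrite -mem_IkS /pt -surjective_pairing; apply: valP.
Qed.

(** Inside M one has x_q = y_q - y_p for some p covered by q, and this is at least z_p. *)
Lemma zeta_ge0_inv : (forall p, 0 <= zeta x p) -> forall p, 0 <= x p.
Proof.
move=> z0; apply: (@coord_ind (fun v => 0 <= v)) => i j Iij.
have [Mij|nM] := boolP (inM r k i j); last first.
  by rewrite coord_outside_M //; case: ifP => _; apply: (coord_ge0 z0).
have [a [b [c ->]]] := x_inside Iij Mij; have [Mab _ _] := covP c.
have := coord_ge0 z0 (pt a b); rewrite -/(z a b) (z_y Mab (cov_neq_top c)).
by rewrite !subr_ge0 => /le_trans; apply; exact: up_lb c.
Qed.

(** Going down from the top of M, z gives integral differences of y to the value at the top; that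
    value is integral too because y vanishes at (k, 1). *)
Lemma zeta_lattice_inv : lattice_point (zeta x) -> lattice_point x.
Proof.
move=> z0; have zint q : coord (zeta x) q \is a Num.int.
  by rewrite /coord; case: insubP => // *; apply: rpred0.
have yd : forall i j, inM r k i j -> y i j - y (r + k)%N k.+1 \is a Num.int.
  apply: (@downward (fun i j => y i j - y (r + k)%N k.+1 \is a Num.int)).
    by rewrite subrr rpred0.
  move=> i j Mij ne ih.
  have [a [b [c E]]] := up_attained k_gt0 k_lt_s s_le_r y Mij ne.
  rewrite (_ : y i j = y a b - z i j); last by rewrite (z_y Mij ne) E; ring.
  by rewrite addrAC rpredB ?ih //; apply: zint.
have yint i j : inM r k i j -> y i j \is a Num.int.
  move=> Mij; rewrite -[y i j]subr0 -(maxval_bot k_gt0 k_lt_s s_le_r x).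
  have -> : y i j - maxval x k 1 = (y i j - y (r + k)%N k.+1) -
      (y k 1%N - y (r + k)%N k.+1) by rewrite /y; ring.
  by rewrite rpredB ?yd // /inM; clear -k_gt0 k_lt_r; lia.
apply: (@coord_ind (fun v => v \is a Num.int)) => i j Iij.
have [Mij|nM] := boolP (inM r k i j); last first.
  by rewrite coord_outside_M //; case: ifP => _; apply: zint.
have [a [b [c ->]]] := x_inside Iij Mij; have [Mab _ _] := covP c.
by rewrite rpredB ?yint.
Qed.

Lemma zeta_polygonal (l : R) : (forall p, 0 <= x p) ->
  (forall C, polygonal C -> \sum_(p in C) x p <= l) <->
  (forall C, polygonal C -> \sum_(p in C) zeta x p <= l).
Proof.
move=> x0; have z0 := zeta_ge0 x0.
have [P1 P2] := polygonal_path_sums (isT : 0 < k.+1)%N k_lt_s s_le_r x0 l.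
have [Q1 Q2] := polygonal_path_sums k_gt0 (ltnW k_lt_s) s_le_r z0 l.
split=> h C.
  apply: Q2; apply: path_sums_le_zx (P1 h) => //.
  + by move=> i j; apply: coord_inside_M.
  + by move=> i j; apply: z_y.
  + by move=> i j _; apply: coord_ge0.
apply: P2; apply: path_sums_le_xz (Q1 h) => //.
+ by move=> i j; apply: coord_inside_M.
+ by move=> i j; apply: z_y.
+ by move=> i j _; apply: coord_ge0.
Qed.

End OnePoint.

Let zeta_diff (x x' : intermediate r s k.+1 -> R) i j : zeta x = zeta x' -> inM r k i j ->
  maxval x i j = maxval x' i j +
    (maxval x (r + k)%N k.+1 - maxval x' (r + k)%N k.+1).
Proof.
move=> E; move: i j; set d := _ - _.
apply: (@downward (fun i j => maxval x i j = maxval x' i j + d)).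
  by rewrite /d addrC subrK.
move=> i j Mij ne ih.
have Iij : pt i j \in intermediate r s k by rewrite mem_Ik inM_Ik.
have zE (u : intermediate r s k.+1 -> R) :
  zeta u [` Iij]%fset = up r k (maxval u) i j - maxval u i j by rewrite zeta_inM.
have := zE x; rewrite E zE (up_shift Mij ne ih).
by move=> /eqP; rewrite subr_eq => /eqP; lra.
Qed.

(** Equal images give values of y that differ by a constant, which is 0 since y vanishes at (k,
    1). *)
Lemma zeta_inj : injective (@zeta R r s k).
Proof.
move=> x x' E; have yE i j : inM r k i j -> maxval x i j = maxval x' i j.
  move=> Mij; rewrite (zeta_diff E Mij).
  have Mbot : inM r k k 1 by rewrite /inM; clear -k_gt0 k_lt_r; lia.
  have := zeta_diff E Mbot; rewrite !maxval_bot // add0r => <-.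
  by rewrite addr0.
apply/funext => p; rewrite -!coord_val [val p]surjective_pairing.
have : inI r s k.+1 (val p).1 (val p).2.
  by rewrite -mem_IkS /pt -surjective_pairing; apply: valP.
move: (val p).1 (val p).2 => i j Iij.
have [Mij|nM] := boolP (inM r k i j); last by rewrite !coord_outside_M // E.
have ne : (i, j) != (k, 1%N) by move: Iij; rewrite /inI xpair_eqE; clear; lia.
rewrite !coord_inside_M // yE //; congr (_ - _); apply: low_eq => // a b /covP[Mab _ _].
exact: yE.
Qed.

Section Surjectivity.
Variable z : intermediate r s k -> R.

(** Solves y = [up] y - z downwards from the value 0 at the top of M. The argument [n] is fuel; [Y]
    supplies the number of steps to the top, and [y] is normalised to vanish at (k, 1) as [maxval]
    does. *)
Fixpoint descend (n i j : nat) : R :=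
  if n is n'.+1 then
    (if j == k.+1 then descend n' i.+1 j else if onL r i j then descend n' i j.+1
     else Num.min (descend n' i.+1 j) (descend n' i j.+1)) - coord z (pt i j)
  else 0.

Let Y i j := descend (r + k + k.+1 - (i + j)) i j.
Let y i j := Y i j - Y k 1%N.

Let Y_rec i j : inM r k i j -> (i, j) != ((r + k)%N, k.+1) ->
  coord z (pt i j) = up r k y i j - y i j.
Proof.
move=> Mij ne; rewrite (up_shift (y' := Y) (d := - Y k 1%N) Mij ne) // /y.
suff -> : Y i j = up r k Y i j - coord z (pt i j) by ring.
have lt : (i + j < r + k + k.+1)%N.
  by move: Mij ne; rewrite /inM xpair_eqE; clear; lia.
rewrite [LHS]/Y -(subnSK lt) /= /up /Y.
by rewrite (_ : i.+1 + j = (i + j).+1)%N // (_ : i + j.+1 = (i + j).+1)%N // addnS.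
Qed.

Let xf (p : point) : R :=
  if inM r k p.1 p.2 then y p.1 p.2 - low r k y p.1 p.2
  else if (k.+1 < p.2)%N then coord z (pt p.1.-1 p.2) else coord z (pt p.1 p.2.-1).

Let x (p : intermediate r s k.+1) : R := xf (val p).

Let x_coord i j : inI r s k.+1 i j -> coord x (pt i j) = xf (pt i j).
Proof. by rewrite -mem_IkS => Iij; rewrite -[pt i j]/(val [` Iij]%fset) coord_val. Qed.

(** [x] is chosen such that [y] satisfies the recursion [maxval_rec] with the same initial value
    0. *)
Let maxval_y i j : inM r k i j -> maxval x i j = y i j.
Proof.
have [n] := ubnP (i + j); elim: n i j => // n ih i j lt Mij.
have [[-> ->]|ne] := eqVneq (i, j) (k, 1%N).
  by rewrite maxval_bot // /y subrr.
rewrite maxval_rec // x_coord ?inM_IkS // /xf Mij.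
rewrite (low_eq (y' := y) Mij ne) ?subrK // => a b /covP[Mab _ E].
by apply: ih => //; move: lt; case: E => -[-> ->]; clear; lia.
Qed.

Lemma zeta_surj : exists x, zeta x = z.
Proof.
exists x; apply/funext => p; rewrite -[RHS]coord_val.
have Ip : inI r s k (val p).1 (val p).2.
  by rewrite -mem_Ik /pt -surjective_pairing; apply: valP.
have [Mp|nMp] := boolP (inM r k (val p).1 (val p).2).
  rewrite zeta_inM // [val p in RHS]surjective_pairing.
  move: Ip Mp; move: (val p).1 (val p).2 => i j Iij Mij.
  have ne : (i, j) != ((r + k)%N, k.+1) by move: Iij; rewrite /inI xpair_eqE; clear; lia.
  rewrite -[(i, j)]/(pt i j) Y_rec // maxval_y //; congr (_ - _).
  rewrite (up_shift (y' := y) (d := 0) Mij ne) ?addr0 // => a b /covP[_ Mab _].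
  by rewrite maxval_y // addr0.
rewrite zeta_notinM // [val p in RHS]surjective_pairing.
move: Ip nMp; move: (val p).1 (val p).2 => i j Iij nMij.
have [jk|kj] := ltnP k.+1 j.
  rewrite x_coord; last by move: Iij jk; rewrite /inI; clear; lia.
  by rewrite /xf /= jk; case: ifP => //; move: jk; rewrite /inM; clear; lia.
have nM : inM r k i j.+1 = false.
  by move: Iij nMij kj; rewrite /inM /inI; clear -k_gt0 k_lt_r; lia.
have kj' : (k.+1 < j.+1)%N = false.
  by move: Iij nMij kj; rewrite /inM /inI; clear -k_gt0 k_lt_r; lia.
rewrite x_coord /xf /= ?nM ?kj' //.
by move: Iij nMij kj; rewrite /inM /inI; clear -k_gt0 k_lt_r; lia.
Qed.

End Surjectivity.

Lemma zeta_bij (l : nat) : set_bij (dilate l (@polygonal_chain_polytope R r s k.+1))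
  (dilate l (@polygonal_chain_polytope R r s k)) (@zeta R r s k).
Proof.
rewrite !dilate_polygonal //; last exact: ltnW.
split.
- by move=> x [x0 xC]; split; [exact: zeta_ge0|apply/zeta_polygonal].
- by move=> x x' _ _; apply: zeta_inj.
- move=> z [z0 zC]; have [x E] := zeta_surj z.
  have x0 : forall p, 0 <= x p by apply: zeta_ge0_inv => p; rewrite E.
  by exists x => //; split => //; apply/zeta_polygonal => // C; rewrite E; apply: zC.
Qed.

End ZetaBijection.

(** * Piecewise linearity, integrality and continuity *)

Section PiecewiseLinear.
Variables (R : realType) (A B : finType).
Implicit Types (h c x : A -> R) (F G : (A -> R) -> R).

Definition dot h x : R := \sum_p h p * x p.

Lemma dotDl h c x : dot (fun p => h p + c p) x = dot h x + dot c x.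
Proof. by rewrite /dot -big_split; apply: eq_bigr => p _; rewrite mulrDl. Qed.

Lemma dotBl h c x : dot (fun p => h p - c p) x = dot h x - dot c x.
Proof. by rewrite /dot -sumrB; apply: eq_bigr => p _; rewrite mulrBl. Qed.

Definition dots (c : B -> A -> R) x : B -> R := fun b => dot (c b) x.

Lemma dots_is_linear (c : B -> A -> R) : linear (dots c).
Proof.
move=> a x y; apply/funext => b; rewrite /dots /dot.
rewrite -[RHS]/(a * (\sum_p c b p * x p) + \sum_p c b p * y p).
rewrite mulr_sumr -big_split; apply: eq_bigr => p _ /=.
by rewrite -[(a *: x + y) p]/(a * x p + y p); ring.
Qed.

HB.instance Definition _ (c : B -> A -> R) :=
  GRing.isLinear.Build R (A -> R) (B -> R) _ (dots c) (dots_is_linear c).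

Definition cone (hs : seq (A -> R)) : set (A -> R) :=
  [set x | forall h, h \in hs -> dot h x <= 0].

Lemma cone_cat hs hs' x : cone (hs ++ hs') x <-> cone hs x /\ cone hs' x.
Proof.
split=> [xh|[xh xh'] h].
  by split=> h hh; apply: xh; rewrite mem_cat hh ?orbT.
by rewrite mem_cat => /orP[/xh|/xh'].
Qed.

Lemma polyhedron_cone hs : polyhedron (cone hs).
Proof.
exists (size hs), (fun j => tnth (in_tuple hs) j), (fun=> 0).
apply/seteqP; split=> x xh; first by move=> j; apply: xh; apply: mem_tnth.
by move=> h /(@tnthP _ _ (in_tuple hs))[j ->]; apply: xh.
Qed.

Definition piecewise_linear F : Prop :=
  exists (I : finType) (hs : I -> seq (A -> R)) (c : I -> A -> R),
    (forall x, exists i, cone (hs i) x) /\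
    (forall i x, cone (hs i) x -> F x = dot (c i) x).

Lemma piecewise_linear_dot c : piecewise_linear (dot c).
Proof.
by exists unit, (fun=> [::]), (fun=> c); split=> // x; exists tt.
Qed.

(** The common refinement of both covers is subdivided by the cones [k b], where [b] records the
    selected argument of a maximum or minimum. *)
Lemma piecewise_linear_comb F G H (f : bool -> R -> R -> R)
    (g : bool -> (A -> R) -> (A -> R) -> (A -> R))
    (k : bool -> (A -> R) -> (A -> R) -> seq (A -> R)) :
  (forall b h c x, dot (g b h c) x = f b (dot h x) (dot c x)) ->
  (forall h c x, exists b, cone (k b h c) x) ->
  (forall b h c x, cone (k b h c) x -> F x = dot h x -> G x = dot c x ->
     H x = f b (dot h x) (dot c x)) ->
  piecewise_linear F -> piecewise_linear G -> piecewise_linear H.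
Proof.
move=> gE kE HE [I [hs [c [cov FE]]]] [I' [hs' [c' [cov' GE]]]].
exists (bool * (I * I'))%type.
exists (fun t => k t.1 (c t.2.1) (c' t.2.2) ++ (hs t.2.1 ++ hs' t.2.2)).
exists (fun t => g t.1 (c t.2.1) (c' t.2.2)); split=> [x|[b [i i']] x /=].
  have [i xi] := cov x; have [i' xi'] := cov' x; have [b xb] := kE (c i) (c' i') x.
  by exists (b, (i, i')); apply/cone_cat; split=> //; apply/cone_cat.
move=> /cone_cat[xb /cone_cat[xi xi']].
by rewrite gE (HE b _ _ _ xb (FE _ _ xi) (GE _ _ xi')).
Qed.

Lemma piecewise_linearD F G : piecewise_linear F -> piecewise_linear G ->
  piecewise_linear (fun x => F x + G x).
Proof.
apply: (piecewise_linear_comb (f := fun=> +%R) (g := fun=> fun h c p => h p + c p)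
  (k := fun=> fun=> fun=> [::])).
- by move=> *; apply: dotDl.
- by move=> *; exists true => h; rewrite in_nil.
- by move=> _ h c x _ -> ->.
Qed.

Lemma piecewise_linearB F G : piecewise_linear F -> piecewise_linear G ->
  piecewise_linear (fun x => F x - G x).
Proof.
apply: (piecewise_linear_comb (f := fun=> fun u v => u - v)
  (g := fun=> fun h c p => h p - c p) (k := fun=> fun=> fun=> [::])).
- by move=> *; apply: dotBl.
- by move=> *; exists true => h; rewrite in_nil.
- by move=> _ h c x _ -> ->.
Qed.

Let sel_cone (b : bool) h c : seq (A -> R) :=
  [:: if b then fun p => h p - c p else fun p => c p - h p].

Let sel_coneP b h c x : cone (sel_cone b h c) x <->
  if b then dot h x <= dot c x else dot c x <= dot h x.
Proof.
rewrite /sel_cone; split=> [/(_ _ (mem_head _ _))|le h'].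
  by case: b; rewrite dotBl subr_le0.
by rewrite inE => /eqP ->; case: b le; rewrite dotBl subr_le0.
Qed.

Let sel_cone_cover h c x : exists b, cone (sel_cone b h c) x.
Proof.
by have [le|/ltW le] := leP (dot h x) (dot c x); [exists true|exists false];
  apply/sel_coneP.
Qed.

Lemma piecewise_linear_max F G : piecewise_linear F -> piecewise_linear G ->
  piecewise_linear (fun x => Num.max (F x) (G x)).
Proof.
apply: (piecewise_linear_comb (f := fun b u v => if b then v else u)
  (g := fun b h c => if b then c else h) (k := sel_cone)) => [[]//||[] h c x] //.
- by move=> /sel_coneP le -> ->; apply/max_idPr.
- by move=> /sel_coneP le -> ->; apply/max_idPl.
Qed.

Lemma piecewise_linear_min F G : piecewise_linear F -> piecewise_linear G ->
  piecewise_linear (fun x => Num.min (F x) (G x)).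
Proof.
apply: (piecewise_linear_comb (f := fun b u v => if b then u else v)
  (g := fun b h c => if b then h else c) (k := sel_cone)) => [[]//||[] h c x] //.
- by move=> /sel_coneP le -> ->; apply/min_idPl.
- by move=> /sel_coneP le -> ->; apply/min_idPr.
Qed.

Lemma piecewise_linear_components D (f : (A -> R) -> (B -> R)) :
  (forall b, piecewise_linear (fun x => f x b)) -> piecewise_linear_on D f.
Proof.
move=> fPL.
(* A cover on which all components are linear is obtained by refining it for one component after the
   other. *)
have [I [hs [c [cov fE]]]] : exists (I : finType) (hs : I -> seq (A -> R))
    (c : I -> B -> A -> R), (forall x, exists i, cone (hs i) x) /\
    (forall i x, cone (hs i) x -> forall b, b \in enum B -> f x b = dot (c i b) x).
  elim: (enum B) => [|b s [I [hs [c [cov fE]]]]].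
    by exists unit, (fun=> [::]), (fun=> fun=> fun=> 0); split=> // x; exists tt.
  have [I' [hs' [c' [cov' fE']]]] := fPL b.
  exists (I' * I)%type, (fun t => hs' t.1 ++ hs t.2),
    (fun t a => if a == b then c' t.1 else c t.2 a).
  split=> [x|[i' i] x /cone_cat[xi' xi] a].
    have [i xi] := cov x; have [i' xi'] := cov' x.
    by exists (i', i); apply/cone_cat.
  rewrite inE; case: eqVneq => [->|_] /= => [_|]; first exact: fE'.
  exact: fE.
exists #|I|, (fun j => cone (hs (enum_val j))), (fun j => dots (c (enum_val j))).
split=> [j|x _|j x _ xj].
- exact: polyhedron_cone.
- by have [i xi] := cov x; exists (enum_rank i); rewrite ?enum_rankK.
- by apply/funext => b; rewrite (fE _ _ xj b) // mem_enum.
Qed.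

End PiecewiseLinear.

Section ZetaRegularity.
Variables (R : realType) (r s k : nat).
Hypothesis k_gt0 : (0 < k)%N.
Hypothesis k_lt_s : (k < s)%N.
Hypothesis s_le_r : (s <= r)%N.

Lemma zeta_piecewise_linear D : piecewise_linear_on D (@zeta R r s k).
Proof.
apply: piecewise_linear_components; apply: zeta_closed_class => //.
- move=> p; have -> : (fun x : intermediate r s k.+1 -> R => x p) =
      dot (fun q => (q == p)%:R).
    apply/funext => x; rewrite /dot (bigD1 p) //= eqxx mul1r big1 ?addr0 // => q.
    by move=> /negbTE ->; rewrite mul0r.
  exact: piecewise_linear_dot.
- have -> : (fun=> 0) = dot (fun=> 0) :> ((intermediate r s k.+1 -> R) -> R).
    by apply/funext => x; rewrite /dot big1 // => q; rewrite mul0r.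
  exact: piecewise_linear_dot.
- exact: piecewise_linearD.
- exact: piecewise_linearB.
- exact: piecewise_linear_max.
- exact: piecewise_linear_min.
Qed.

Lemma zeta_lattice D : lattice_preserving_on D (@zeta R r s k).
Proof.
move=> x _ xint p; move: x xint.
apply: (@zeta_closed_class R r s k k_gt0 k_lt_s s_le_r
  (fun F => forall x, lattice_point x -> F x \is a Num.int)) => //.
- by move=> F G hF hG x xint; rewrite rpredD ?hF ?hG.
- by move=> F G hF hG x xint; rewrite rpredB ?hF ?hG.
- by move=> F G hF hG x xint; rewrite maxEle; case: ifP => _; [apply: hG|apply: hF].
- by move=> F G hF hG x xint; rewrite minEle; case: ifP => _; [apply: hF|apply: hG].
Qed.

Lemma continuous_ptws (T : topologicalType) (B : finType) (f : T -> {ptws B -> R}) :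
  (forall b, continuous (fun x => f x b : R)) -> continuous f.
Proof.
move=> fc x; apply/cvg_sup => b.
by apply: (@continuous_comp_initial _ _ _ (fun g : B -> R => g b)); apply: fc.
Qed.

Lemma continuous_op (T : topologicalType) (F G : T -> R) :
  continuous F -> continuous G ->
  [/\ continuous (fun x => F x + G x), continuous (fun x => F x - G x),
    continuous (fun x => Num.max (F x) (G x)) &
    continuous (fun x => Num.min (F x) (G x))].
Proof.
move=> hF hG; split=> x.
- by apply: cvgD; [exact: hF|exact: hG].
- by apply: cvgB; [exact: hF|exact: hG].
- exact: (continuous_max (hF x) (hG x)).
- exact: (continuous_min (hF x) (hG x)).
Qed.

Lemma zeta_continuous D : continuous_on D (@zeta R r s k).
Proof.
rewrite /continuous_on; apply: continuous_subspaceT.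
apply: continuous_ptws.
pose T : topologicalType := {ptws intermediate r s k.+1 -> R}.
apply: (@zeta_closed_class R r s k k_gt0 k_lt_s s_le_r
  (fun F => continuous (F : T -> R))).
- by move=> p; apply: (@proj_continuous _ (fun=> R) p).
- by move=> x; apply: cst_continuous.
- by move=> F G hF hG; case: (@continuous_op T F G hF hG).
- by move=> F G hF hG; case: (@continuous_op T F G hF hG).
- by move=> F G hF hG; case: (@continuous_op T F G hF hG).
- by move=> F G hF hG; case: (@continuous_op T F G hF hG).
Qed.

End ZetaRegularity.

(** * Counting lattice points *)

Section OrderPolynomial.
Local Open Scope nat_scope.
Variables (T : finType) (le : rel T).

Definition monotone_maps (N : nat) : {set {ffun T -> 'I_N}} :=
  [set f : {ffun T -> 'I_N} | [forall p, forall q, le p q ==> (f p <= f q)]]%SET.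

Lemma monotone_mapsP N (f : {ffun T -> 'I_N}) :
  reflect (forall p q, le p q -> f p <= f q) (f \in monotone_maps N).
Proof.
rewrite inE; apply: (iffP forallP) => h p; last first.
  by apply/forallP => q; apply/implyP; apply: h.
by move=> q; move/forallP: (h p) => /(_ q)/implyP.
Qed.

Definition onto_monotone (m : nat) : nat :=
  #|[set f in monotone_maps m | f @: [set: T] == [set: 'I_m]]%SET|.

(** Composition with [Order.enum_val], the increasing bijection onto [A], turns surjective monotone
    maps into those with image [A]. *)
Lemma card_monotone_image N (A : {set 'I_N}) :
  #|[set f in monotone_maps N | f @: [set: T] == A]%SET| = onto_monotone #|A|.
Proof.
pose h (g : {ffun T -> 'I_#|A|}) : {ffun T -> 'I_N} :=
  [ffun p => Order.enum_val (g p)].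
have h_inj : injective h.
  move=> g g' /ffunP E; apply/ffunP => p; have := E p; rewrite !ffunE.
  exact: Order.enum_val_inj.
have le_ev (i j : 'I_#|A|) :
    ((Order.enum_val i : 'I_N) <= (Order.enum_val j : 'I_N)) = (i <= j).
  have := Order.le_enum_val (@Order.le_total _ _ : total (<=%O : rel 'I_N)) (A := A) i j.
  by rewrite !leEord.
rewrite /onto_monotone -(card_imset _ h_inj); apply: eq_card => f.
rewrite !inE; apply/idP/imsetP => [/andP[fm /eqP fA]|[g + ->]].
  have fE p : exists i : 'I_#|A|, Order.enum_val i = f p.
    have fpA : f p \in A by rewrite -fA imset_f.
    by exists (Order.enum_rank_in fpA (f p)); rewrite Order.enum_rankK_in.
  have [g gE] := fin_all_exists fE.
  have hg : f = h (finfun g) by apply/ffunP => p; rewrite !ffunE gE.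
  exists (finfun g) => //; rewrite !inE; apply/andP; split.
    apply/forallP => p; apply/forallP => q; apply/implyP => pq.
    rewrite !ffunE -le_ev !gE.
    by move/forallP: fm => /(_ p)/forallP/(_ q)/implyP; apply.
  apply/eqP/setP => i; rewrite finset.in_setT; apply/imsetP.
  have subA (a : 'I_N) : a \in A -> a \in f @: [set: T]%SET by rewrite fA.
  have /subA/imsetP[p _ E] := Order.enum_valP i.
  exists p => //; rewrite ffunE.
  by apply: Order.enum_val_inj; rewrite gE.
rewrite !inE => /andP[gm /eqP gT]; apply/andP; split.
  apply/forallP => p; apply/forallP => q; apply/implyP => pq.
  by rewrite !ffunE le_ev; move/forallP: gm => /(_ p)/forallP/(_ q)/implyP; apply.
apply/eqP/setP => a; apply/imsetP/idP => [[p _ ->]|aA].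
  by rewrite ffunE Order.enum_valP.
have : Order.enum_rank_in aA a \in g @: [set: T]%SET by rewrite gT finset.in_setT.
case/imsetP => p _ E; exists p => //.
by rewrite ffunE -E Order.enum_rankK_in.
Qed.

Lemma onto_monotone_gt m : #|T| < m -> onto_monotone m = 0.
Proof.
move=> Tm; apply/eqP; rewrite cards_eq0; apply/eqP/setP => f; rewrite !inE.
apply/negP => /andP[_ /eqP E].
have := leq_imset_card f [set: T]%SET.
by rewrite E !cardsT card_ord leqNgt Tm.
Qed.

(** The maps are sorted by their image, whose size is at most [#|T|]; hence the number is polynomial
    in [N]. *)
Lemma card_monotone_maps N :
  #|monotone_maps N| = \sum_(m < #|T|.+1) 'C(N, m) * onto_monotone m.
Proof.
rewrite -sum1_card.
rewrite (partition_big (fun f : {ffun T -> 'I_N} => f @: [set: T]%SET) xpredT) //=.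
transitivity (\sum_(A : {set 'I_N}) onto_monotone #|A|).
  apply: eq_bigr => A _; rewrite -card_monotone_image -sum1_card.
  by apply: eq_bigl => f; rewrite !inE.
transitivity (\sum_(A : {set 'I_N}) \sum_(m < #|T|.+1 | #|A| == m :> nat) onto_monotone m).
  apply: eq_bigr => A _; have [lt|le'] := ltnP #|A| #|T|.+1.
    by rewrite (big_pred1 (Ordinal lt)).
  rewrite onto_monotone_gt // big1 // => m /eqP E.
  by have := ltn_ord m; rewrite -E ltnNge le'.
rewrite (exchange_big_dep xpredT) //=; apply: eq_bigr => m _.
rewrite sum_nat_const; congr (_ * _).
by rewrite -[N in 'C(N, _)]card_ord -card_draws cardsE.
Qed.

End OrderPolynomial.

(** The binomial coefficient of X + 1 over m. *)
Definition binomial_poly (m : nat) : {poly rat} :=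
  (m`!%:R : rat)^-1 *: \prod_(i < m) ('X + (1 - i%:R)%:P).

Lemma binomial_polyE (m l : nat) : (binomial_poly m).[l%:R] = 'C(l.+1, m)%:R.
Proof.
rewrite /binomial_poly hornerZ horner_prod.
have -> : \prod_(i < m) ('X + (1 - i%:R)%:P).[l%:R] = (l.+1 ^_ m)%:R :> rat.
  elim: m => [|m ih]; first by rewrite big_ord0 ffactn0.
  rewrite big_ord_recr /= ih ffactnSr natrM !hornerE.
  (* For m > l + 1 the subtraction of natural numbers truncates, but the falling factorial is
     already 0. *)
  have [ml|lm] := leqP m l.+1; last by rewrite ffact_small // !mul0r.
  by rewrite natrB // -[l.+1%:R]natr1.
by rewrite -bin_ffact natrM mulrC mulfK // pnatr_eq0 -lt0n fact_gt0.
Qed.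

(** * Stanley's transfer map for chain-bounded lattice points *)

Section Transfer.
Local Open Scope nat_scope.
Variables (T : finType) (le : rel T).
Hypothesis le_refl : reflexive le.
Hypothesis le_anti : antisymmetric le.
Hypothesis le_trans : transitive le.

Let chain (C : {set T}) : bool := [forall p in C, forall q in C, le p q || le q p].

Let chainP (C : {set T}) :
  reflect (forall p q, p \in C -> q \in C -> le p q || le q p) (chain C).
Proof.
apply: (iffP forall_inP) => h p; first by move=> q pC; apply: (forall_inP (h _ pC)).
by move=> pC; apply/forall_inP => q; apply: h.
Qed.

Let chain_sub (C D : {set T}) : D \subset C -> chain C -> chain D.
Proof.
by move=> /fintype.subsetP s /chainP h; apply/chainP => p q /s pC /s; apply: h.
Qed.

Let lt p q := le p q && (p != q).

Let rank (p : T) := #|[set q | le q p]%SET|.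

Let rank_lt p q : lt p q -> rank p < rank q.
Proof.
move=> /andP[pq ne]; apply: proper_card; apply/properP; split.
  by apply/fintype.subsetP => a; rewrite !inE => /le_trans; apply.
exists q; rewrite !inE ?le_refl //; apply: contra ne => qp.
by apply/eqP/le_anti; rewrite pq qp.
Qed.

Let chain_top (C : {set T}) : chain C -> C != finset.set0 ->
  exists2 p, p \in C & forall q, q \in C -> q != p -> lt q p.
Proof.
move=> /chainP chC /set0Pn[p0 p0C].
case: (arg_maxnP rank p0C) => p pC maxp; exists p => // q qC ne.
rewrite /lt ne andbT; have /orP[//|pq] := chC _ _ qC pC.
have := maxp _ qC; rewrite /= leqNgt => /negP[]; apply: rank_lt.
by rewrite /lt pq eq_sym.
Qed.

(** An empty maximum is 0, so the increment of [g] at a minimal element is its value there. *)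
Let below (g : T -> nat) p := \max_(q | lt q p) g q.

Let monotone_fun (g : T -> nat) := forall p q, le p q -> g p <= g q.

Let below_le g p : monotone_fun g -> below g p <= g p.
Proof. by move=> gm; apply/bigmax_leqP => q /andP[/gm]. Qed.

(** The sum telescopes from the top [p] of the chain: by induction the other increments add up to at
    most [below g p]. *)
Lemma chain_sum_increments g C : monotone_fun g -> chain C ->
  \sum_(p in C) (g p - below g p) <= \max_(p in C) g p.
Proof.
move=> gm; have [n] := ubnP #|C|; elim: n C => // n ih C lt_n chC.
have [->|C0] := eqVneq C finset.set0; first by rewrite big_set0.
have [p pC topp] := chain_top chC C0.
rewrite (big_setD1 p) //=; apply: (@leq_trans (g p)); last exact: (leq_bigmax_cond p).
rewrite -leq_subRL ?leq_subr // subKn ?below_le //.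
apply: leq_trans (ih (C :\ p) _ _) _.
- by move: lt_n; rewrite (cardsD1 p) pC.
- exact: chain_sub (subD1set _ _) chC.
- apply/bigmax_leqP => q /setD1P[ne qC].
  by apply: (leq_bigmax_cond q); apply: topp.
Qed.

Lemma increments_inj g g' : monotone_fun g -> monotone_fun g' ->
  (forall p, g p - below g p = g' p - below g' p) -> g =1 g'.
Proof.
move=> gm gm' E p; have [n] := ubnP (rank p); elim: n p => // n ih p lt_n.
have bE : below g p = below g' p.
  apply: eq_bigr => q /rank_lt qp; apply: ih.
  by apply: leq_trans qp _; rewrite -ltnS.
by rewrite -(subnK (below_le p gm)) E bE subnK // below_le.
Qed.

(** [g p] is the largest weight of a chain of elements at most [p]. Adding [p] to an optimal chain
    strictly below it shows that the increment at [p] is [x p]. *)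
Lemma increments_surj (x : T -> nat) (l : nat) :
  (forall C, chain C -> \sum_(p in C) x p <= l) ->
  exists g, [/\ monotone_fun g, forall p, g p <= l & forall p, x p = g p - below g p].
Proof.
move=> xl; pose g p := \max_(C | chain C && [forall q in C, le q p]) \sum_(q in C) x q.
have gmax p (C : {set T}) : chain C -> (forall q, q \in C -> le q p) ->
    \sum_(q in C) x q <= g p.
  move=> chC Cp; apply: (leq_bigmax_cond C); rewrite chC; exact/forall_inP.
have gm : monotone_fun g.
  move=> p q pq; apply/bigmax_leqP => C /andP[chC /forall_inP Cp].
  by apply: gmax => // a /Cp /le_trans; apply.
have ltbelow p (C : {set T}) : chain C -> (forall q, q \in C -> lt q p) ->
    \sum_(q in C) x q <= below g p.
  move=> chC Cp; have [->|C0] := eqVneq C finset.set0; first by rewrite big_set0.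
  have [q qC topq] := chain_top chC C0.
  apply: leq_trans (leq_bigmax_cond q (Cp _ qC)); apply: gmax => // a aC.
  by have [->//|/(topq _ aC)/andP[]] := eqVneq a q.
exists g; split=> // [p|p].
  by apply/bigmax_leqP => C /andP[chC _]; apply: xl.
have xg : x p <= g p.
  rewrite -[x p](big_set1 addn p x); apply: gmax => [|q /set1P->//].
  by apply/chainP => q q' /set1P-> /set1P->; rewrite le_refl.
have gE : g p <= x p + below g p.
  apply/bigmax_leqP => C /andP[chC /forall_inP Cp].
  have [pC|npC] := boolP (p \in C).
    rewrite (big_setD1 p) //= leq_add2l; apply: ltbelow.
      exact: chain_sub (subD1set _ _) chC.
    by move=> q /setD1P[ne /Cp qp]; rewrite /lt qp.
  apply: leq_trans (leq_addl _ _); apply: ltbelow => // q qC.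
  by rewrite /lt Cp //; apply: contraNneq npC => <-.
have Eg : x p + below g p <= g p.
  rewrite -leq_subRL //; apply/bigmax_leqP => q /andP[qp ne].
  apply/bigmax_leqP => C /andP[chC /forall_inP Cq].
  have npC : p \notin C.
    by apply: contra ne => /Cq pq; apply/eqP/le_anti; rewrite qp pq.
  rewrite leq_subRL // -(big_setU1 _ npC) /=; apply: gmax.
    apply/chainP => a b /setU1P[->|aC] /setU1P[->|bC].
    - by rewrite le_refl.
    - by rewrite (le_trans (Cq _ bC) qp) orbT.
    - by rewrite (le_trans (Cq _ aC) qp).
    - exact: (chainP _ chC).
  by move=> a /setU1P[->|/Cq aq] //; apply: le_trans aq qp.
by apply/eqP; rewrite -(eqn_add2r (below g p)) subnK ?below_le // eqn_leq gE Eg.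
Qed.

Lemma chain_bounded_card (R : realType) (l : nat) :
  ([set x : T -> R | [/\ forall p, (0 <= x p)%R, lattice_point x &
      forall C, chain C -> (\sum_(p in C) x p <= l%:R)%R]] #= `I_#|monotone_maps le l.+1|)%card.
Proof.
set Y := monotone_maps le l.+1.
pose f0 : {ffun T -> 'I_l.+1} := [ffun=> ord0].
pose F (n : nat) : {ffun T -> 'I_l.+1} := nth f0 (enum Y) n.
pose G (f : {ffun T -> 'I_l.+1}) (p : T) : R := (f p - below (fun q => f q) p)%:R%R.
have FY n : n < #|Y| -> F n \in Y.
  by move=> nY; rewrite -mem_enum /F mem_nth // -cardE.
have Ym f : f \in Y -> monotone_fun (fun p => f p).
  by move/monotone_mapsP.
rewrite (_ : mkset _ = (fun n => G (F n)) @` `I_#|Y|).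
  apply: inj_card_eq => n n'; rewrite !inE /= => nY n'Y E.
  have FE : F n = F n'.
    apply/ffunP => p; apply: val_inj; move: p.
    apply: (increments_inj (Ym _ (FY _ nY)) (Ym _ (FY _ n'Y))) => p.
    by apply/eqP; rewrite -(eqr_nat R); apply/eqP; apply: (congr1 (fun h => h p) E).
  apply/eqP; rewrite -(nth_uniq f0 _ _ (enum_uniq Y)) -?cardE //.
  exact/eqP.
apply/seteqP; split=> [x [x0 xint xC]|_ [n nY <-]]; last first.
  split=> [p|p|C chC]; first exact: ler0n.
    by rewrite natr_int.
  rewrite -natr_sum ler_nat.
  apply: (leq_trans (chain_sum_increments (Ym _ (FY _ nY)) chC)).
  by apply/bigmax_leqP => p _; rewrite -ltnS.
have xnat p : exists n : nat, x p = n%:R%R.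
  by apply/natrP; rewrite natrEint xint x0.
have [u uE] := fin_all_exists xnat.
have [|g [gm gl gE]] := @increments_surj u l.
  move=> C chC; rewrite -(ler_nat R) natr_sum.
  by rewrite (eq_bigr x) ?xC // => p _; rewrite uE.
pose f : {ffun T -> 'I_l.+1} := [ffun p => inord (g p)].
have fg p : f p = g p :> nat by rewrite ffunE inordK // ltnS.
have fY : f \in Y by apply/monotone_mapsP => p q /gm; rewrite !fg.
exists (index f (enum Y)); first by rewrite /= cardE index_mem mem_enum.
rewrite /F nth_index ?mem_enum //; apply/funext => p.
rewrite /G uE gE fg; congr (_ - _)%:R%R.
by apply: eq_bigr => q _; rewrite fg.
Qed.

End Transfer.

(** * The common Ehrhart polynomial *)

Section Ehrhart.
Variables (R : realType) (r s : nat).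
Hypothesis s_gt0 : (0 < s)%N.
Hypothesis s_le_r : (s <= r)%N.

Let I1 := intermediate r s 1.
Let leI (p q : I1) : bool := (val p <= val q)%O.

(* All maximal chains of the rectangle I_1 are polygonal. *)
Lemma rectangle_polytope (l : nat) :
  dilate l (@polygonal_chain_polytope R r s 1) `&` @lattice_point R I1 =
  [set x | [/\ forall p, 0 <= x p, lattice_point x &
    forall C : {set I1}, is_chain C -> \sum_(p in C) x p <= l%:R]].
Proof.
rewrite dilate_polygonal //; apply/seteqP; split=> x [].
  move=> [x0 xC] xint; split=> // C chC.
  (* The point (1, 1) is special and the least element of I_1, so it can be added to any chain. *)
  have I11 : pt 1 1 \in I1 by rewrite mem_intermediate // /inI; lia.
  pose b : I1 := [` I11]%fset.
  have bmin (q : I1) : (val b <= val q)%O.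
    have : inI r s 1 (val q).1 (val q).2.
      rewrite -(mem_intermediate (isT : 0 < 1)%N s_le_r s_gt0) /pt.
      by rewrite -surjective_pairing; apply: valP.
    by rewrite Order.ProdOrder.leEprod /= !leEnat => /and3P[-> ->].
  apply: (@le_trans _ _ (\sum_(p in b |: C) x p)).
    rewrite [leRHS](big_setID C) /= (finset.setIidPr (finset.subsetUr _ _)) lerDl.
    exact: sumr_ge0.
  apply: (special_chain_le x0 xC).
    apply/forall_inP => p /setU1P[->|pC]; apply/forall_inP => q /setU1P[->|qC].
    - exact: comparablexx.
    - by rewrite /Order.comparable bmin.
    - by rewrite /Order.comparable bmin orbT.
    - exact: (forall_inP (forall_inP chC _ pC)).
  by exists b; rewrite ?setU11 // /special eqxx orbT.
move=> x0 xint xC; split=> //; split=> // C /polygonalP[/maxsetP[chC _] _].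
exact: xC.
Qed.

Let leI_refl : reflexive leI. Proof. by move=> p; apply: lexx. Qed.
Let leI_anti : antisymmetric leI.
Proof. by move=> p q h; apply/val_inj/le_anti. Qed.
Let leI_trans : transitive leI. Proof. by move=> p q t; apply: le_trans. Qed.

Definition ehrhart_poly : {poly rat} :=
  \sum_(m < #|{: I1}|.+1) (onto_monotone leI m)%:R *: binomial_poly m.

(** Lattice preservation alone would only give an injection; [zeta_lattice_inv] makes it onto. *)
Lemma zeta_card (k l : nat) : (0 < k)%N -> (k < s)%N ->
  (dilate l (@polygonal_chain_polytope R r s k) `&` @lattice_point R _ #=
   dilate l (@polygonal_chain_polytope R r s k.+1) `&` @lattice_point R _)%card.
Proof.
move=> k0 ks; have [fD fI fS] := zeta_bij R k0 ks s_le_r l.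
rewrite (_ : _ `&` _ = @zeta R r s k @`
  (dilate l (@polygonal_chain_polytope R r s k.+1) `&` @lattice_point R _)).
  apply: inj_card_eq => x x' _ _; exact: (zeta_inj k0 ks s_le_r).
apply/seteqP; split=> [z [/fS[x xD <-] zint]|_ [x [xD xint] <-]].
  by exists x; [split; [exact: xD|exact: (zeta_lattice_inv k0 ks s_le_r zint)]|].
by split; [exact: fD|exact: (zeta_lattice k0 ks s_le_r xD xint)].
Qed.

Lemma ehrhart_polyP (k : nat) : (1 <= k <= s)%N ->
  is_Ehrhart_polynomial (@polygonal_chain_polytope R r s k) ehrhart_poly.
Proof.
move=> k1s l; exists #|monotone_maps leI l.+1|; split; last first.
  rewrite /ehrhart_poly horner_sum card_monotone_maps natr_sum.
  by apply: eq_bigr => m _; rewrite hornerZ binomial_polyE natrM mulrC.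
(* Starting from the rectangle I_1, the count is carried from k to k + 1 by [zeta]. *)
elim: k k1s => // k ih k1s; have [->|k0] := posnP k.
  by rewrite rectangle_polytope; apply: chain_bounded_card.
apply: card_eq_trans (ih _); last lia.
by rewrite card_eq_sym; apply: zeta_card => //; lia.
Qed.

End Ehrhart.

Theorem theorem4p11 (R : realType) (r s : nat) (s_gt0 : (0 < s)%N)
    (s_le_r : (s <= r)%N) :
  (forall k : nat, (1 <= k <= s - 1)%N -> forall l : nat,
     let D := dilate l (@polygonal_chain_polytope R r s k.+1) in
     let E := dilate l (@polygonal_chain_polytope R r s k) in
     let f := @zeta R r s k in
     [/\ continuous_on D f,
         piecewise_linear_on D f,
         lattice_preserving_on D f &
         set_bij D E f]) /\
  (exists q : {poly rat}, forall k : nat, (1 <= k <= s)%N ->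
     is_Ehrhart_polynomial (@polygonal_chain_polytope R r s k) q).
Proof.
split=> [k /andP[k0 ks] l D E f|].
  have {}ks : (k < s)%N by lia.
  split; [exact: zeta_continuous|exact: zeta_piecewise_linear|
    exact: zeta_lattice|exact: zeta_bij].
by exists (ehrhart_poly r s) => k; apply: ehrhart_polyP.
Qed.
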